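(* Let $D=(V(D),E(D),w)$ be a weighted oriented bipartite graph, i.e. a weighted oriented graph whose underlying simple graph $G$ is bipartite. Then the following statements are equivalent: (1) $I(D)$ is componentwise linear; (2) $I(D)$ is vertex splittable; (3) $I(D)$ has the linear quotient property.
   Context: A weighted oriented graph $D=(V(D),E(D),w)$ consists of a finite vertex set $V(D)=\{x_1,\dots,x_n\}$, a set $E(D)$ of directed edges $(x,y)$ (from $x$ towards $y$) between distinct vertices, obtained by orienting each edge of a simple graph in exactly one direction, and a weight function $w:V(D)\to\{1,2,3,\dots\}$. Its underlying simple graph $G$ has $V(G)=V(D)$ and $E(G)=\{\{x,y\}: (x,y)\in E(D)\text{ or }(y,x)\in E(D)\}$. Identifying vertices with variables of $R=\mathbb{K}[x_1,\dots,x_n]$, $\mathbb{K}$ a field, the edge ideal is $I(D)=(x_ix_j^{w(x_j)} : (x_i,x_j)\in E(D))\subseteq R$. If a vertex is a source (has no incoming edge), its weight does not affect $I(D)$ and by convention is taken to be $1$. For a homogeneous ideal $I\subseteq R$ and $d\ge 0$, $I_{\langle d\rangle}$ denotes the ideal generated by all homogeneous elements of degree $d$ in $I$. $I$ is componentwise linear if for each $d\geq 0$ the ideal $I_{\langle d\rangle}$ has a $d$-linear resolution over $R$, i.e. is zero or satisfies $\operatorname{reg}(I_{\langle d\rangle})=d$ (Castelnuovo–Mumford regularity). For a monomial ideal $I$, $\mathcal{G}(I)$ denotes its minimal set of monomial generators. $I$ has the linear quotient property if there is an ordering $u_1<\cdots<u_m$ of $\mathcal{G}(I)$ such that the colon ideal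 $((u_1,\dots,u_{i-1}):u_i)$ is generated by a subset of the variables for $i=2,\dots,m$. A monomial ideal $I\subseteq\mathbb{K}[X]$ ($X$ a finite set of variables) is vertex splittable if it can be obtained by the following recursive procedure: (i) if $v$ is a monomial and $I=(v)$, or $I=(0)$, or $I$ is the whole ring, then $I$ is vertex splittable; (ii) if there are a variable $x\in X$ and vertex splittable ideals $I_1,I_2$ of $\mathbb{K}[X\setminus\{x\}]$ such that $I=xI_1+I_2$ (with $I_1, I_2$ viewed through their extensions to $\mathbb{K}[X]$), $I_2\subseteq I_1$, and $\mathcal{G}(I)$ is the disjoint union of $\mathcal{G}(xI_1)$ and $\mathcal{G}(I_2)$, then $I$ is vertex splittable. *)

(* Defs.v *)
From HB Require Import structures.
From mathcomp Require Import all_boot all_order all_algebra.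
From mathcomp Require Import mpoly.

Set Implicit Arguments.
Unset Strict Implicit.
Unset Printing Implicit Defensive.

Import GRing.Theory.
Local Open Scope ring_scope.

(* Vertices are the indices of the variables of {mpoly K[n]}; the last field is
   the usual convention that a source has weight 1. *)
Record wograph (n : nat) := WOGraph {
  arc : rel 'I_n;
  weight : 'I_n -> nat;
  arc_irr : irreflexive arc;
  arc_asym : forall x y, arc x y -> ~~ arc y x;
  weight_gt0 : forall x, (0 < weight x)%N;
  weight_source : forall x, (forall y, ~~ arc y x) -> weight x = 1%N
}.

Definition underlying n (D : wograph n) : rel 'I_n :=
  fun x y => arc D x y || arc D y x.

Definition bipartite n (g : rel 'I_n) : Prop :=
  exists A : {set 'I_n}, forall x y, g x y -> (x \in A) != (y \in A).

(* Ideals are handled as subsets of the polynomial ring, compared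
   extensionally with eqset. *)
Definition polyset (K : fieldType) (n : nat) := {mpoly K[n]} -> Prop.

Section Ideals.
Variables (K : fieldType) (n : nat).
Local Notation R := {mpoly K[n]}.
Implicit Types (I J S : polyset K n).

Definition eqset I J : Prop := forall p, I p <-> J p.

Definition ideal_gen S : polyset K n := fun p =>
  exists2 s : seq (R * R),
    (forall c, c \in s -> S c.2) & p = \sum_(c <- s) c.1 * c.2.

Definition monomials (G : seq 'X_{1..n}) : polyset K n :=
  fun p => exists2 m, m \in G & p = 'X_[m].

Definition variables (Y : {set 'I_n}) : polyset K n :=
  fun p => exists2 y, y \in Y & p = 'X_y.

(* u * I and I + J, for ideals I and J *)
Definition scale_ideal (u : R) I : polyset K n :=
  fun p => exists2 q, I q & p = u * q.

Definition add_ideal I J : polyset K n :=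
  fun p => exists q r, [/\ I q, J r & p = q + r].

Definition colon I (u : R) : polyset K n := fun p => I (p * u).

Definition edge_ideal (D : wograph n) : polyset K n :=
  ideal_gen (fun p => exists x y, arc D x y /\ p = 'X_x * 'X_y ^+ weight D y).

(* G enumerates without repetition the minimal set of monomial generators. *)
Definition min_mon_gens I (G : seq 'X_{1..n}) : Prop :=
  [/\ uniq G,
      eqset I (ideal_gen (monomials G))
    & forall G' : seq 'X_{1..n}, {subset G' <= G} ->
        eqset I (ideal_gen (monomials G')) -> {subset G <= G'}].

Definition linear_quotients I : Prop :=
  exists2 u : seq 'X_{1..n}, min_mon_gens I u &
    forall i, (0 < i < size u)%N ->
      exists Y : {set 'I_n},
        eqset (colon (ideal_gen (monomials (take i u))) 'X_[nth 0%MM u i])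
              (ideal_gen (variables Y)).

(* vertex_splittable X I : I is the extension to {mpoly K[n]} of a vertex
   splittable ideal of the polynomial ring in the variables of index in X.
   Extension is injective on ideals, commutes with sums and multiplication by
   a variable, reflects inclusion and preserves minimal monomial generators.
   Disjointness of G1 and G2 is part of min_mon_gens I (G1 ++ G2). *)
Inductive vertex_splittable : {set 'I_n} -> polyset K n -> Prop :=
| VSplit_monomial (X : {set 'I_n}) I (v : 'X_{1..n}) of
    (forall x, v x != 0%N -> x \in X)
    & eqset I (ideal_gen (eq 'X_[v])) : vertex_splittable X I
| VSplit_zero (X : {set 'I_n}) I of
    eqset I (eq 0) : vertex_splittable X I
| VSplit_full (X : {set 'I_n}) I of
    eqset I (fun=> True) : vertex_splittable X I
| VSplit_step (X : {set 'I_n}) I (x : 'I_n) I1 I2 (G1 G2 : seq 'X_{1..n}) of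
    x \in X
    & vertex_splittable (X :\ x) I1
    & vertex_splittable (X :\ x) I2
    & eqset I (add_ideal (scale_ideal 'X_x I1) I2)
    & (forall p, I2 p -> I1 p)
    & min_mon_gens (scale_ideal 'X_x I1) G1
    & min_mon_gens I2 G2
    & min_mon_gens I (G1 ++ G2) : vertex_splittable X I.

(* Data of a complex ... -> F_1 -> F_0 -> R of graded free modules, where F_i
   consists of row vectors, its k-th basis vector has degree shift i k
   (so F_i = \bigoplus_k R(- shift i k)), and maps are right products. *)
Record free_complex := FreeComplex {
  rank : nat -> nat;
  shift : forall i, 'I_(rank i) -> nat;
  diff : forall i, 'M[R]_(rank i.+1, rank i);
  aug : 'cV[R]_(rank 0)
}.

(* p is homogeneous of degree a - b, hence zero if a < b *)
Definition homog_sub (a b : nat) (p : R) : Prop :=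
  if (b <= a)%N then is_true (p \is (a - b).-homog) else p = 0.

Definition graded (F : free_complex) : Prop :=
  (forall k, aug F k 0 \is (@shift F 0 k).-homog) /\
  (forall i k l, homog_sub (@shift F i.+1 k) (@shift F i l) (diff F i k l)).

Definition resolves (F : free_complex) I : Prop :=
  [/\ forall p, I p <-> exists v : 'rV_(rank F 0), p = (v *m aug F) 0 0,
      forall v : 'rV_(rank F 0),
        v *m aug F = 0 <-> exists u, v = u *m diff F 0
    & forall i (v : 'rV_(rank F i.+1)),
        v *m diff F i = 0 <-> exists u, v = u *m diff F i.+1].

(* The differentials have entries in the ideal generated by the variables. *)
Definition minimal (F : free_complex) : Prop :=
  forall i k l, (diff F i k l)@_0%MM = 0.

Definition minimal_graded_resolution (F : free_complex) I : Prop :=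
  [/\ graded F, resolves F I & minimal F].

Definition betti (F : free_complex) (i j : nat) : nat :=
  #|[set k | @shift F i k == j]|.

(* reg I = r, i.e. r is the maximum of j - i over the nonzero graded Betti
   numbers; minimal graded resolutions are unique up to isomorphism, so the
   choice of F is immaterial. *)
Definition regularity I (r : nat) : Prop :=
  exists F : free_complex,
    [/\ minimal_graded_resolution F I,
        exists i j, betti F i j != 0%N /\ j = (r + i)%N
      & forall i j, betti F i j != 0%N -> (j <= r + i)%N].

Definition linear_resolution (d : nat) I : Prop :=
  eqset I (eq 0) \/ regularity I d.

Definition component I (d : nat) : polyset K n :=
  ideal_gen (fun p => I p /\ p \is d.-homog).

Definition componentwise_linear I : Prop :=
  forall d, linear_resolution d (component I d).

End Ideals.

Arguments edge_ideal K {n} D.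

(* Main.v *)
Require Import Defs.
From mathcomp Require Import all_boot all_order all_algebra.
From mathcomp Require Import mpoly.

Set Implicit Arguments.
Unset Strict Implicit.
Unset Printing Implicit Defensive.

Import Order.TTheory GRing.Theory.
Local Open Scope ring_scope.

(** All three properties are compared with one combinatorial condition on the
    arcs of [D], [arcs_linked].  Call an arc light if its target has weight 1
    and heavy otherwise, and let u = x y^w(y) and v be the generators of two
    distinct arcs.  The condition says that some variable a dividing u to a
    higher power than v, or the same with u and v exchanged, is such that a * v
    is divisible by a generator other than v.

    From linear quotients to the condition.  If u precedes v in the order of
    the generators, then (earlier generators) : v contains u / gcd(u, v) and is
    generated by variables, so one of these variables is the wanted a
    ([linear_quotients_exchange]).

    From componentwise linearity to the condition.  Let deg u <= deg v = d.  A
    d-linear resolution of the component of degree d has first syzygies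
    generated by linear forms.  If there is no variable a as above, then
    v is isolated among the monomials of degree d of the ideal that
    divide w = lcm(u, v).  The functional that reads off the coefficient of w
    contributed by the monomial v alone kills every multiple of a linear
    syzygy, but it does not kill the syzygy between v and a multiple u' of u of
    degree d dividing w ([componentwise_linear_exchange]).

    From the condition to vertex splittings, where [D] is bipartite.  No vertex
    has two heavy out-neighbours, no heavy arc is followed by a heavy arc, and
    neither the underlying graph nor the graph of light arcs has an induced
    pair of disjoint edges.  Neighbourhoods on one side are thus nested, so
    both sides have vertices adjacent to every non-isolated vertex of the other
    side, and one finds such a vertex v that can be split off: it occurs to the
    first power only, and every edge monomial without v is divisible by the
    cofactor of an edge at v ([splitting_vertex_exists]).  The cofactors are
    powers of distinct variables, at most one of them not a variable, so they
    generate a vertex splittable ideal too.  Deleting v preserves the four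
    properties, and induction applies ([vertex_splittable_edge_mons]).

    From a vertex splitting I = x I1 + I2 back to the other two properties.
    Listing x G(I1) before G(I2) gives an order with linear quotients, because
    I2 lies in I1 and so every colon by an element of G(I2) gains x.  The same
    works for all monomials of degree d of I: those divisible by x come first
    ([vertex_splittable_gens]).  Finally, an ideal generated in degree d with
    linear quotients has a d-linear resolution.  Adding a generator f to I'
    gives 0 -> I' -> I' + (f) -> R/(I' : f)(-d) -> 0 with I' : f generated by
    variables, hence linearly resolved by the same argument, and the resolutions
    of the two ends combine to block triangular matrices ([horseshoe]). *)

#[local] Hint Resolve lepm_refl : core.

(** * Monomial ideals and their minimal generators *)

Section MonomialIdeals.
Variables (K : fieldType) (n : nat).
Local Notation R := {mpoly K[n]}.
Implicit Types (I J S : polyset K n) (p q : R) (G s t : seq 'X_{1..n}).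

Lemma ideal_gen_incl S p : S p -> ideal_gen S p.
Proof.
move=> Sp; exists [:: (1, p)]; first by move=> c; rewrite inE => /eqP ->.
by rewrite big_seq1 mul1r.
Qed.

Lemma ideal_gen0 S : ideal_gen S 0.
Proof. exists (Nil (R * R)); [by move=> c; rewrite in_nil | by rewrite big_nil]. Qed.

Lemma ideal_genD S p q : ideal_gen S p -> ideal_gen S q -> ideal_gen S (p + q).
Proof.
move=> [s Ss ->] [t St ->]; exists (s ++ t); last by rewrite big_cat.
by move=> c; rewrite mem_cat => /orP[/Ss|/St].
Qed.

Lemma ideal_genM S p q : ideal_gen S q -> ideal_gen S (p * q).
Proof.
move=> [s Ss ->]; exists [seq (p * c.1, c.2) | c <- s].
  by move=> _ /mapP[c cs ->] /=; apply: Ss.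
by rewrite big_map mulr_sumr; apply: eq_bigr => c _; rewrite mulrA.
Qed.

Lemma ideal_gen_sum S (T : eqType) (r : seq T) (F : T -> R) :
  (forall i, i \in r -> ideal_gen S (F i)) -> ideal_gen S (\sum_(i <- r) F i).
Proof.
elim: r => [|i r IHr] SF; first by rewrite big_nil; apply: ideal_gen0.
rewrite big_cons; apply: ideal_genD; first by apply: SF; rewrite mem_head.
by apply: IHr => j jr; apply: SF; rewrite inE jr orbT.
Qed.

(** The set of monomials is a predicate and not a list, so that ideals
    generated by a list, by a set of variables or by one monomial are all
    instances. *)
Lemma mono_idealP (M : 'X_{1..n} -> Prop) p :
  ideal_gen (fun q => exists2 m, M m & q = 'X_[m]) p <->
  forall m, m \in msupp p -> exists2 g, M g & (g <= m)%MM.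
Proof.
split=> [[s Ms ->] m /msupp_sum_le /flatten_mapP[c]|Mp].
  rewrite mem_filter => /andP[_ cs]; have [g Mg ->] := Ms c cs.
  move=> /msuppM_le/allpairsP[[m1 m2] /= [_ ]].
  by rewrite msuppX inE => /eqP -> ->; exists g => //; apply: lem_addl.
rewrite [p]mpolyE; apply: ideal_gen_sum => m /Mp[g Mg le_gm].
rewrite -(submK le_gm) mpolyXD scalerAl; apply: ideal_genM.
by apply: ideal_gen_incl; exists g.
Qed.

Lemma mon_idealP G p :
  ideal_gen (monomials G) p <->
  forall m, m \in msupp p -> exists2 g, g \in G & (g <= m)%MM.
Proof. exact: (mono_idealP (fun m => m \in G)). Qed.

Lemma mon_idealX G m :
  ideal_gen (monomials G) ('X_[m] : R) <-> exists2 g, g \in G & (g <= m)%MM.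
Proof.
rewrite mon_idealP; split=> [|Gm _ /mem_msuppXP <-] //.
by apply; apply/mem_msuppXP.
Qed.

Lemma eq_mon_ideal G G' :
  G =i G' -> eqset (ideal_gen (monomials G : polyset K n)) (ideal_gen (monomials G')).
Proof.
move=> eqG p; rewrite !mon_idealP.
by split=> Gp m /Gp[g]; [rewrite eqG | rewrite -eqG]; exists g.
Qed.

Lemma eqset_trans I J S : eqset I J -> eqset J S -> eqset I S.
Proof. by move=> IJ JS p; rewrite IJ. Qed.

Lemma eqset_sym I J : eqset I J -> eqset J I.
Proof. by move=> IJ p; rewrite IJ. Qed.

Lemma lepm_anti (a b : 'X_{1..n}) : (a <= b)%MM -> (b <= a)%MM -> a = b.
Proof.
move=> /mnm_lepP ab /mnm_lepP ba; apply/mnmP => i.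
by apply/eqP; rewrite eqn_leq ab ba.
Qed.

Definition antichain G := forall a b, a \in G -> b \in G -> (a <= b)%MM -> a = b.

(** Minimality under deletion of generators amounts to the absence of
    divisibilities: a generator divisible by another one can be deleted, and a
    deleted generator must be divisible by a remaining one. *)
Lemma min_mon_gensP I G :
  min_mon_gens I G <->
  [/\ uniq G, eqset I (ideal_gen (monomials G)) & antichain G].
Proof.
split=> [[uG IG minG]|[uG IG acG]]; split=> //.
  move=> a b aG bG le_ab; apply/eqP/negP => /negP neq_ab.
  suff /(_ b bG): {subset G <= filter (predC1 b) G}.
    by rewrite mem_filter /= eqxx.
  apply: minG => [m|p]; first by rewrite mem_filter => /andP[].
  rewrite IG !mon_idealP; split=> Gp m /Gp[g].
    move=> gG le_gm; have [eq_gb|neq_gb] := eqVneq g b.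
      exists a; first by rewrite mem_filter /= neq_ab.
      by apply: lepm_trans le_ab _; rewrite -eq_gb.
    by exists g; rewrite // mem_filter /= neq_gb.
  by rewrite mem_filter => /andP[_]; exists g.
move=> G' subG' IG' b bG.
have /IG'/mon_idealX[g gG' le_gb]: I 'X_[b] by apply/IG/mon_idealX; exists b.
by rewrite -(acG _ _ (subG' _ gG') bG le_gb).
Qed.

Lemma min_mon_gens_unique I G G' :
  min_mon_gens I G -> min_mon_gens I G' -> G =i G'.
Proof.
suff sub A B: min_mon_gens I A -> min_mon_gens I B -> {subset A <= B}.
  by move=> IG IG' m; apply/idP/idP; apply: sub.
move=> /min_mon_gensP[_ IA acA] /min_mon_gensP[_ IB _] a aA.
have /IB/mon_idealX[b bB le_ba]: I 'X_[a] by apply/IA/mon_idealX; exists a.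
have /IA/mon_idealX[c cA le_cb]: I 'X_[b] by apply/IB/mon_idealX; exists b.
have eq_ca := acA _ _ cA aA (lepm_trans le_cb le_ba).
by rewrite (lepm_anti (b := b) _ le_ba) // -eq_ca.
Qed.

End MonomialIdeals.

(** * Linear quotients as a condition on exponents *)

Section LinearQuotients.
Variable n : nat.
Implicit Types (m : 'X_{1..n}) (s t : seq 'X_{1..n}).

(** Says that (s) : m is generated by variables.  The colon is generated by the
    m' / gcd(m, m') with m' in s; each of them is divisible by a variable y,
    which is expressed by m y < m' y, and this y lies in the colon because m''
    divides m * y. *)
Definition linear_colon s m := forall m', m' \in s ->
  exists m'' y, [/\ m'' \in s, (m'' <= m + U_(y))%MM & (m y < m' y)%N].

Definition lq_order s :=
  forall i, (i < size s)%N -> linear_colon (take i s) (nth 0%MM s i).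

Lemma lq_order_rcons s m : lq_order (rcons s m) <-> lq_order s /\ linear_colon s m.
Proof.
split=> [lqs|[lqs lqm] i]; last first.
  rewrite size_rcons ltnS leq_eqVlt nth_rcons -cats1 take_cat.
  case: ltngtP => //= [lt_is _|->]; first exact: lqs.
  by rewrite subnn take0 cats0.
split=> [i lt_is|].
  have := lqs i; rewrite size_rcons ltnS (ltnW lt_is) nth_rcons lt_is.
  by rewrite -cats1 take_cat lt_is; apply.
have := lqs (size s); rewrite size_rcons ltnS leqnn nth_rcons ltnn eqxx.
by rewrite -cats1 take_size_cat //; apply.
Qed.

Lemma linear_colon_cat s t m :
  linear_colon s m -> linear_colon t m -> linear_colon (s ++ t) m.
Proof.
move=> lqs lqt m'; rewrite mem_cat => /orP[/lqs|/lqt] [m'' [y [m''s le lt]]];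
  by exists m'', y; rewrite mem_cat m''s ?orbT.
Qed.

Lemma lq_order_cat s t :
  lq_order s -> lq_order t -> {in t, forall m, linear_colon s m} -> lq_order (s ++ t).
Proof.
move=> lqs; elim/last_ind: t => [|t m IHt]; first by rewrite cats0.
rewrite -rcons_cat !lq_order_rcons => -[lqt lqm] lqst; split.
  by apply: IHt => // m' m't; apply: lqst; rewrite mem_rcons inE m't orbT.
by apply: linear_colon_cat => //; apply: lqst; rewrite mem_rcons mem_head.
Qed.

Lemma lq_order_map s (c : 'X_{1..n}) : lq_order s -> lq_order (map (mnm_add c) s).
Proof.
elim/last_ind: s => [|s m IHs]; first by [].
rewrite map_rcons !lq_order_rcons => -[/IHs lqs lqm]; split=> //.
move=> _ /mapP[m' /lqm[m'' [y [m''s le lt]]] ->]; exists (c + m'')%MM, y.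
split; first by rewrite map_f.
  apply/mnm_lepP => i; move/mnm_lepP/(_ i): le.
  by rewrite !mnmDE -addnA leq_add2l.
by rewrite !mnmDE ltn_add2l.
Qed.

(** If neither m nor m' involves x, then neither does the variable y of
    [linear_colon], nor the monomial m'' dividing m * y; so restricting to the
    monomials free of x keeps every witness. *)
Lemma lq_order_filter_free s (x : 'I_n) :
  lq_order s -> lq_order (filter (fun m : 'X_{1..n} => m x == 0%N) s).
Proof.
elim/last_ind: s => [|s m IHs]; first by [].
rewrite filter_rcons lq_order_rcons => -[/IHs lqs lqm]; case: eqP => // mx0.
rewrite lq_order_rcons; split=> // m'.
rewrite mem_filter => /andP[/eqP m'x0 /lqm[m'' [y [m''s le lt]]]].
exists m'', y; split=> //; rewrite mem_filter m''s andbT -leqn0.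
move/mnm_lepP/(_ x): le; rewrite mnmDE mnm1E mx0.
by case: eqP lt => // ->; rewrite m'x0.
Qed.

Lemma lq_order_uniq s : lq_order s -> uniq s.
Proof.
elim/last_ind: s => // s m IHs; rewrite lq_order_rcons rcons_uniq => -[/IHs -> lqm].
by rewrite andbT; apply/negP => /lqm[m'' [y []]]; rewrite ltnn.
Qed.

(** Sorted in decreasing order.  In a fixed degree the monomial order is
    lexicographic, so monomials with a larger exponent at the first variable in
    which they differ come first. *)
Definition monomials_of_degree (d : nat) : seq 'X_{1..n} :=
  sort (fun a b => (b <= a)%O)
    [seq bmnm b | b : 'X_{1..n < d.+1} <- enum {: 'X_{1..n < d.+1}} & mdeg b == d].

Lemma mem_monomials_of_degree d m : (m \in monomials_of_degree d) = (mdeg m == d).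
Proof.
rewrite mem_sort; apply/mapP/idP => [[b + ->]|deg_m].
  by rewrite mem_filter => /andP[].
have lt_md: (mdeg m < d.+1)%N by rewrite (eqP deg_m).
by exists (BMultinom lt_md); rewrite // mem_filter deg_m mem_enum.
Qed.

(** The excess of m' at i must be compensated by an excess of m later on. *)
Lemma monomial_swap m m' (i : 'I_n) : mdeg m = mdeg m' ->
    (forall j : 'I_n, (j < i)%N -> m j = m' j) -> (m i < m' i)%N ->
  exists2 k : 'I_n, (i < k)%N & (0 < m k)%N.
Proof.
move=> eq_deg eq_lt lt_i.
case: (pickP (fun k : 'I_n => (i < k)%N && (0 < m k)%N)) => [k /andP[]|none].
  by exists k.
suff: (mdeg m < mdeg m')%N by rewrite eq_deg ltnn.
rewrite !mdegE (bigD1 i) //= [ltnRHS](bigD1 i) //= -addSn leq_add //.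
apply: leq_sum => j neq_ji; case: (ltngtP j i) => [lt_ji|lt_ij|eq_ij].
- by rewrite eq_lt.
- by have := none j; rewrite lt_ij lt0n => /negbFE/eqP ->.
- by rewrite (ord_inj eq_ij) eqxx in neq_ji.
Qed.

(** If m' precedes m and y is the first variable in which they differ, move one
    unit of exponent in m from a later variable to y: the result precedes m and
    divides m * y. *)
Lemma lq_order_monomials_of_degree d : lq_order (monomials_of_degree d).
Proof.
set s := monomials_of_degree d; set r := fun a b : 'X_{1..n} => (b <= a)%O.
have rT: transitive r by move=> b a c /= ab bc; apply: le_trans bc ab.
have srt: sorted r s by apply: sort_sorted => a b; apply: le_total.
have us: uniq s.
  rewrite sort_uniq map_inj_uniq ?filter_uniq -?enumT ?enum_uniq // => a b eq_ab.
  exact: val_inj.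
move=> i lt_is m' /[dup] m's /(nthP 0%MM)[j].
rewrite size_take lt_is => lt_ji; rewrite nth_take // => eq_m'.
set m := nth _ s i.
have deg k : (k < size s)%N -> mdeg (nth 0%MM s k) = d.
  by move=> lt_ks; apply/eqP; rewrite -mem_monomials_of_degree mem_nth.
have lt_mm': (m < m')%O.
  rewrite lt_neqAle -eq_m' /m nth_uniq // ?(ltn_trans lt_ji) //.
  rewrite gtn_eqF //=.
  exact: (sorted_ltn_nth rT 0%MM srt) (ltn_trans lt_ji lt_is) lt_is lt_ji.
have deg_m: mdeg m = d by apply: deg.
have deg_m': mdeg m' = d by rewrite -eq_m' deg // (ltn_trans lt_ji).
have /(ltmcP (etrans deg_m (esym deg_m')))[y eq_lt lt_y] := lt_mm'.
have [k lt_yk mk_gt0] := monomial_swap (etrans deg_m (esym deg_m')) eq_lt lt_y.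
have le_k: (U_(k) <= m + U_(y))%MM.
  by rewrite lep1mP mnmDE -lt0n addn_gt0 mk_gt0.
set m'' := (m + U_(y) - U_(k))%MM.
have deg_m'': mdeg m'' = d.
  apply/eqP; rewrite -(eqn_add2r (mdeg U_(k)%MM)) -mdegD submK //.
  by rewrite mdegD !mdeg1 deg_m.
have lt_mm'': (m < m'')%O.
  apply/ltmcP; first by rewrite deg_m.
  exists y => [l lt_ly|]; rewrite mnmBE mnmDE !mnm1E -!val_eqE /=.
    rewrite gtn_eqF // gtn_eqF ?addn0 ?subn0 //; exact: ltn_trans lt_yk.
  by rewrite eqxx gtn_eqF //= subn0 addn1.
exists m'', y; split=> //; last exact: lem_subr.
have m''s: m'' \in s by rewrite mem_monomials_of_degree deg_m''.
rewrite (in_take_leq _ (ltnW lt_is)) ltnNge; apply/negP => le_i.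
suff: (m'' <= m)%O by rewrite leNgt lt_mm''.
rewrite -(nth_index 0%MM m''s).
have rR: reflexive r by move=> a; apply: lexx.
by apply: (sorted_leq_nth rT rR 0%MM srt); rewrite ?inE ?index_mem.
Qed.

(** Both ideals are spanned by monomials.  From left to right, Y is the set of
    variables in the colon ideal; from right to left, the monomial m' / gcd(m, m')
    lies in the colon, so one of the variables of Y divides it. *)
Lemma colon_linear (K : fieldType) s m :
  linear_colon s m <-> exists Y : {set 'I_n},
    eqset (colon (ideal_gen (monomials s)) ('X_[m] : {mpoly K[n]}))
          (ideal_gen (variables Y)).
Proof.
have colonP (p : {mpoly K[n]}) : colon (ideal_gen (monomials s)) 'X_[m] p <->
    forall k, k \in msupp p -> exists2 g, g \in s & (g <= m + k)%MM.
  rewrite /colon mon_idealP; split=> sp k.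
    by move=> kp; apply: sp; rewrite (perm_mem (msuppMX _ _)) map_f.
  by rewrite (perm_mem (msuppMX _ _)) => /mapP[k' /sp ? ->].
have varP Y (p : {mpoly K[n]}) : ideal_gen (variables Y) p <->
    forall k : 'X_{1..n}, k \in msupp p -> exists2 y, y \in Y & k y != 0%N.
  have -> : ideal_gen (variables Y) p <->
      ideal_gen (fun q => exists2 g : 'X_{1..n},
        (exists2 y, y \in Y & g = U_(y)%MM) & q = 'X_[g]) p.
    by split=> -[c Yc ->]; exists c => // a /Yc[];
      [move=> y yY ->; exists U_(y)%MM => //; exists y
      | move=> _ [y yY ->] ->; exists y].
  rewrite (mono_idealP (fun g => exists2 y, y \in Y & g = U_(y)%MM)).
  split=> Yp k /Yp[].
    by move=> _ [y yY ->]; rewrite lep1mP; exists y.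
  by move=> y yY ky; exists U_(y)%MM; [exists y | rewrite lep1mP].
split=> [lqm|[Y eqY]].
  exists [set y | has (fun g => (g <= m + U_(y))%MM) s] => p.
  rewrite colonP varP; split=> sp k /sp[].
    move=> g /lqm[m'' [y [m''s le_m'' lt_y]]] /mnm_lepP/(_ y) le_g; exists y.
      by rewrite inE; apply/hasP; exists m''.
    by move: (leq_trans lt_y le_g); rewrite mnmDE -addn1 leq_add2l lt0n.
  move=> y; rewrite inE => /hasP[g gs le_g] ky; exists g => //.
  apply: lepm_trans le_g _; apply/mnm_lepP => i.
  by rewrite !mnmDE leq_add2l; apply/mnm_lepP: i; rewrite lep1mP.
move=> m' m's.
have /eqY/varP Ym': colon (ideal_gen (monomials s)) 'X_[m] ('X_[m' - m] : {mpoly K[n]}).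
  apply/colonP => k /mem_msuppXP <-; exists m' => //.
  by apply/mnm_lepP => i; rewrite mnmDE mnmBE -maxnE leq_maxr.
have [|y yY] := Ym' (m' - m)%MM; first exact/mem_msuppXP.
rewrite mnmBE -lt0n subn_gt0 => lt_y.
have /eqY/colonP Yy: ideal_gen (variables Y) ('X_y : {mpoly K[n]}).
  by apply: ideal_gen_incl; exists y.
by have [|m'' m''s le] := Yy U_(y)%MM; [apply/mem_msuppXP | exists m'', y].
Qed.

Lemma linear_quotientsP (K : fieldType) (I : polyset K n) :
  linear_quotients I <-> exists2 u, min_mon_gens I u & lq_order u.
Proof.
split=> -[u Iu lqu]; exists u => // i.
  case: i => [|i] lt_i; first by rewrite take0.
  by apply/(colon_linear K); apply: lqu.
by move=> /andP[_ lt_i]; apply/colon_linear; apply: lqu.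
Qed.

End LinearQuotients.

(** * Linear free resolutions *)

(** Constructive because [rel] is decidable and each X i is a choice type. *)
Lemma dependent_choice (X : nat -> choiceType) (good : forall i, X i -> Prop)
    (rel : forall i, X i -> X i.+1 -> bool) (x0 : X 0%N) :
    good 0%N x0 -> (forall i x, good i x -> exists y, rel i x y) ->
    (forall i x y, good i x -> rel i x y -> good i.+1 y) ->
  exists2 F : forall i, X i, F 0%N = x0 & forall i, rel i (F i) (F i.+1).
Proof.
move=> good0 next good_next.
pose step i (x : {x | good i x}) : {y : {y | good i.+1 y} | rel i (sval x) (sval y)} :=
  let y := sigW (next i (sval x) (svalP x)) in
  exist _ (exist _ (sval y) (good_next i _ _ (svalP x) (svalP y))) (svalP y).
pose G := fix G i : {x | good i x} :=
  if i is j.+1 return {x | good i x} then sval (step j (G j)) else exist _ x0 good0.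
by exists (fun i => sval (G i)) => // i; apply: (svalP (step i (G i))).
Qed.

Section LinearResolutions.
Variables (K : fieldType) (n : nat).
Local Notation R := {mpoly K[n]}.
Implicit Types (I J L : polyset K n) (p q f : R).

(** Multiplication by a homogeneous polynomial shifts the graded pieces. *)
Lemma pihomogM_homog (d e : nat) p q :
  q \is e.-homog -> pihomog mdeg (d + e) (p * q) = pihomog mdeg d p * q.
Proof.
move=> hq; rewrite [p]mpolyE mulr_suml !raddf_sum mulr_suml /=.
apply: eq_bigr => m _; rewrite -scalerAl !linearZ /= -scalerAl; congr (_ *: _).
have hX: 'X_[m] * q \is (mdeg m + e).-homog by rewrite dhomogM // dhomogX.
rewrite pihomogX; have [<-|neq_d] := eqVneq (mdeg m) d.
  by rewrite pihomog_dE.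
by rewrite mul0r (pihomog_ne0 _ hX) // eqn_add2r.
Qed.

(** Lift each row arbitrarily and keep only the component of degree d of the
    entries: comparing degrees, this is still a lift. *)
Lemma homog_lift (d e a b c : nat) (A : 'M[R]_(a, b)) (W : 'M[R]_(c, b)) :
    (forall k l, A k l \is e.-homog) -> (forall k l, W k l \is (d + e).-homog) ->
    (forall k, exists v : 'rV_a, row k W = v *m A) ->
  exists2 T : 'M[R]_(c, a), forall k l, T k l \is d.-homog & T *m A = W.
Proof.
move=> hA hW /fin_all_exists[v vP].
exists (\matrix_(k, l) pihomog mdeg d (v k 0 l)) => [k l|].
  by rewrite mxE pihomogP.
apply/matrixP => k l; rewrite -(pihomog_dE (hW k l)).
have /rowP/(_ l) := vP k; rewrite !mxE => ->; rewrite raddf_sum /=.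
by apply: eq_bigr => j _; rewrite mxE pihomogM_homog.
Qed.

Lemma homogM_mx (d e a b c : nat) (A : 'M[R]_(a, b)) (B : 'M[R]_(b, c)) :
    (forall k l, A k l \is d.-homog) -> (forall k l, B k l \is e.-homog) ->
  forall k l, (A *m B) k l \is (d + e).-homog.
Proof.
by move=> hA hB k l; rewrite mxE rpred_sum // => j _; apply: dhomogM.
Qed.

(** A resolution of an ideal I is written as a complex of free modules ending in
    R -> R/I, whose last term has rank 1; the augmentation is then the matrix
    of index 0, and the exactness conditions become uniform. *)
Definition ranks (r : nat -> nat) (i : nat) : nat := if i is j.+1 then r j else 1%N.

(** Linearity of all the differentials beyond the augmentation already forces
    minimality, as linear forms have no constant term. *)
Definition linear_complex (d : nat) I (r : nat -> nat)
    (A : forall i, 'M[R]_(ranks r i.+1, ranks r i)) : Prop :=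
  [/\ forall i k l, A i k l \is (if i is 0%N then d else 1%N).-homog,
      forall p, I p <-> exists v : 'rV_(r 0%N), p = (v *m A 0%N) 0 0
    & forall i (v : 'rV_(r i)), v *m A i = 0 <->
        exists u : 'rV_(r i.+1), v = u *m A i.+1].

Definition linearly_resolved (d : nat) I : Prop :=
  exists r A, @linear_complex d I r A.

Lemma linearly_resolved_eqset d I J :
  eqset I J -> linearly_resolved d I -> linearly_resolved d J.
Proof.
move=> IJ [r [A [hA IA exA]]]; exists r, A; split=> // p.
by rewrite -IA IJ.
Qed.

(** The module of index i is generated in degree d + i.  If the first module is
    zero, so is the ideal. *)
Lemma linearly_resolved_regularity d I :
  linearly_resolved d I -> linear_resolution d I.
Proof.
move=> [r [A [hA IA exA]]]; case r0: (r 0%N) => [|r0'].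
  left=> p; rewrite IA; split=> [[v ->]|<-].
    by rewrite mxE big1 // => -[i /= lt_i]; exfalso; rewrite r0 in lt_i.
  by exists 0; rewrite mul0mx mxE.
right; exists (@FreeComplex K n r (fun i _ => (d + i)%N) (fun i => A i.+1) (A 0%N)).
split; last first.
- move=> i j; rewrite /betti -lt0n => /card_gt0P[k].
  by rewrite inE => /eqP <-.
- exists 0%N, d; rewrite addn0; split=> //.
  rewrite /betti -lt0n; apply/card_gt0P.
  (* Rank positive, hence the Betti number at (0, d) is nonzero. *)
  have lt_r: (0 < r 0%N)%N by rewrite r0.
  by exists (Ordinal lt_r); rewrite inE /= addn0.
split.
- split=> [k|i k l] /=; first by rewrite addn0; apply: (hA 0%N).
  rewrite /homog_sub addnS leqnSn subSn // subnn; exact: (hA i.+1).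
- split=> //=; first exact: (exA 0%N).
  by move=> i; apply: (exA i.+1).
- move=> i k l /=; apply: (dhomog_nemf_coeff (hA i.+1 k l)).
  by rewrite mf0.
Qed.

Lemma linearly_resolved_zero d : linearly_resolved d (eq 0 : polyset K n).
Proof.
exists (fun=> 0%N), (fun=> 0); split=> [i k l|p|i v].
- by rewrite mxE rpred0.
- by split=> [<-|[v ->]]; [exists 0|]; rewrite mulmx0 mxE.
- split=> [_|_]; last by rewrite mulmx0.
  by exists 0; rewrite mul0mx; apply/rowP => -[].
Qed.

(** Exactness at one spot of the combined complex.  The relation between T and
    T' makes the block matrices compose to zero.  Conversely, write
    v2 = w * C; then v1 - w * T' is a cycle of the complex of A. *)
(** The horseshoe lemma for 0 -> I -> J -> (R/L)(-d) -> 0.  The blocks [T i] form,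
    up to sign, a map of complexes from the resolution of R/L to that of R/I
    lifting the multiplication by f, and are constructed one after the other.
    Since the generators of I and f have the same degree and L is generated in
    degree 1, all entries of the combined matrices are again linear. *)
Lemma horseshoe_exact (a b a' b' c : nat) (A : 'M[R]_(a, c)) (A' : 'M[R]_(a', a))
    (T : 'M[R]_(b, c)) (T' : 'M[R]_(b', a)) (C : 'M[R]_(b', b))
    (v1 : 'rV_a) (v2 : 'rV_b) :
    T' *m A = - (C *m T) ->
    (forall v : 'rV_a, v *m A = 0 <-> exists u : 'rV_a', v = u *m A') ->
  (v1 *m A + v2 *m T = 0 /\ exists w : 'rV_b', v2 = w *m C) <->
  exists u : 'rV_(a' + b'), row_mx v1 v2 = u *m block_mx A' 0 T' C.
Proof.
move=> TA exA; split=> [[eq0 [w v2E]]|[u]].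
  have [u1 v1E]: exists u1, v1 - w *m T' = u1 *m A'.
    by apply/exA; rewrite mulmxBl -mulmxA TA mulmxN opprK mulmxA -v2E.
  exists (row_mx u1 w); rewrite mul_row_block mulmx0 add0r -v2E -v1E.
  by rewrite subrK.
rewrite -[u]hsubmxK mul_row_block mulmx0 add0r => /eq_row_mx[-> ->].
have AA: A' *m A = 0.
  apply/row_matrixP => i; rewrite row_mul row0.
  by apply/exA; exists (delta_mx 0 i); rewrite -rowE.
split; last by exists (rsubmx u).
by rewrite mulmxDl -!mulmxA AA mulmx0 add0r TA mulmxN addNr.
Qed.

Lemma horseshoe d I L J f :
    linearly_resolved d I -> linearly_resolved 1 L -> f \is d.-homog ->
    eqset L (colon I f) ->
    (forall p, J p <-> exists a b, I a /\ p = a + b * f) ->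
  linearly_resolved d J.
Proof.
move=> [r [A [hA IA exA]]] [q [C [hC LC exC]]] hf eqL JE.
have hC1 i k l: C i k l \is 1.-homog by have := hC i k l; case: i k l.
pose X i : choiceType := 'M[R]_(ranks q i, ranks r i).
pose deg i := if i is 0%N then d else 1%N.
pose good i (T : X i) := (forall k l, T k l \is (deg i).-homog) /\
  forall k, exists v : 'rV_(r i), row k (C i *m T) = v *m A i.
pose rel i (T : X i) (T' : X i.+1) :=
  [forall k, forall l, T' k l \is 1.-homog] && (T' *m A i == - (C i *m T)).
have rowCf k: exists v : 'rV_(r 0%N), row k (C 0%N *m f%:M) = v *m A 0%N.
  have /eqL/IA[v vE]: L (C 0%N k 0).
    by apply/LC; exists (delta_mx 0 k); rewrite -rowE mxE.
  exists v; rewrite mul_mx_scalar; apply/rowP => j.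
  by rewrite (ord1 j) -vE !mxE mulrC.
have [||i T T' good_T|T T0 TE] := @dependent_choice X good rel f%:M.
- split=> // k l; rewrite mxE.
  by case: (_ == _); rewrite ?mulr1n ?mulr0n ?rpred0 //.
- move=> i T [hT CT].
  have [|k l|k|T' hT' TE] := @homog_lift 1 (deg i) _ _ _ (A i) (- (C i *m T)).
  + by move=> k l; apply: hA.
  + by rewrite mxE rpredN; apply: homogM_mx.
  + have [v vE] := CT k; exists (- v).
    by apply/rowP => j; move/rowP/(_ j): vE; rewrite mulNmx !mxE => ->.
  exists T'; rewrite /rel TE eqxx andbT.
  by apply/forallP => k; apply/forallP => l; apply: hT'.
- move=> /andP[/forallP hT' /eqP TE]; split=> [k l|k].
    by apply: (forallP (hT' k)).
  apply/exA; rewrite -row_mul -mulmxA TE mulmxN mulmxA.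
  have -> : C i.+1 *m C i = 0.
    apply/row_matrixP => j; rewrite row_mul row0.
    by apply/exC; exists (delta_mx 0 j); rewrite -rowE.
  by rewrite mul0mx oppr0 row0.
have {}TE i: T i.+1 *m A i = - (C i *m T i) /\
    forall k l, T i.+1 k l \is 1.-homog.
  have /andP[/forallP hT /eqP ->] := TE i; split=> // k l.
  exact: (forallP (hT k)).
(* The map of complexes starts with the multiplication by f on R. *)
have T0E (v : 'rV_1) : v *m T 0%N = const_mx (v 0 0 * f).
  rewrite T0 mul_mx_scalar; apply/rowP => j.
  by rewrite (ord1 j) !mxE mulrC.
pose t i := (r i + ranks q i)%N.
pose N i : 'M[R]_(ranks t i.+1, ranks t i) :=
  match i return 'M[R]_(ranks t i.+1, ranks t i) with
  | 0%N => col_mx (A 0%N) (T 0%N)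
  | j.+1 => block_mx (A j.+1) 0 (T j.+1) (C j)
  end.
exists t, N; split=> [[|i]|p|[|i] v].
- move=> k l; rewrite /= mxE; case: split => j; first exact: (hA 0%N).
  rewrite T0 mxE; case: (_ == _); rewrite ?mulr1n ?mulr0n ?rpred0 //.
- move=> k l; rewrite /= mxE; case: split => j; rewrite mxE; case: split => j'.
  + exact: (hA i.+1).
  + by rewrite mxE rpred0.
  + exact: (TE i).2.
  + exact: hC1.
- rewrite JE; split=> [[a [b [/IA[v ->] ->]]]|[v ->]].
    exists (row_mx v (const_mx b)).
    by rewrite (mul_row_col v) T0E !mxE.
  rewrite -[v]hsubmxK (mul_row_col (lsubmx v)) T0E.
  exists (((lsubmx v) *m A 0%N) 0 0), (rsubmx v 0 0); split; last by rewrite !mxE.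
  by apply/IA; exists (lsubmx v).
- rewrite -[v]hsubmxK (mul_row_col (lsubmx v)).
  move: (lsubmx v) (rsubmx v) => v1 v2.
  have v2C: v1 *m A 0%N + v2 *m T 0%N = 0 -> exists w : 'rV_(q 0%N), v2 = w *m C 0%N.
    move=> eq0; have /LC[w wE]: L (v2 0 0).
      apply/eqL/IA; exists (- v1); rewrite mulNmx.
      have -> : v1 *m A 0%N = - (v2 *m T 0%N) by apply/eqP; rewrite -addr_eq0 eq0.
      by rewrite opprK T0E mxE.
    by exists w; apply/rowP => j; rewrite (ord1 j) wE.
  rewrite -(horseshoe_exact _ _ (TE 0%N).1 (exA 0%N)).
  by split=> [eq0|[]//]; split=> //; apply: v2C.
- rewrite -[v]hsubmxK /= (mul_row_block (lsubmx v)) mulmx0 add0r.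
  rewrite -(horseshoe_exact _ _ (TE i.+1).1 (exA i.+1)) -exC.
  split=> [|[-> ->]]; last by rewrite row_mx0.
  by rewrite -[RHS]row_mx0 => /eq_row_mx.
Qed.

(** Singles out the new generator as the polynomial f to which [horseshoe]
    applies. *)
Lemma mon_ideal_rcons (s : seq 'X_{1..n}) (m : 'X_{1..n}) p :
  ideal_gen (monomials (rcons s m)) p <->
  exists a b, ideal_gen (monomials s) a /\ p = a + b * 'X_[m].
Proof.
split=> [[l lP ->]|[a [b [/mon_idealP sa ->]]]].
  elim: l lP => [|c l IHl] lP.
    exists 0, 0; rewrite mul0r addr0 big_nil; split=> //; exact: ideal_gen0.
  have [|a [b [sa lE]]] := IHl.
    by move=> c' c'l; apply: lP; rewrite inE c'l orbT.
  rewrite big_cons lE; have [k] := lP c (mem_head _ _).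
  rewrite mem_rcons inE => /predU1P[->|ks] ->.
    by exists a, (c.1 + b); split=> //; rewrite mulrDl addrCA.
  exists (c.1 * 'X_[k] + a), b; split; last by rewrite addrA.
  by apply: ideal_genD => //; apply: ideal_genM; apply: ideal_gen_incl; exists k.
apply: ideal_genD; last first.
  by apply: ideal_genM; apply: ideal_gen_incl; exists m; rewrite // mem_rcons mem_head.
apply/mon_idealP => k /sa[g gs le_gk]; exists g => //.
by rewrite mem_rcons inE gs orbT.
Qed.

Lemma mon_ideal_nil : eqset (eq 0 : polyset K n) (ideal_gen (monomials [::])).
Proof.
move=> p; split=> [<-|/mon_idealP sp]; first exact: ideal_gen0.
apply/eqP; rewrite eq_sym -msupp_eq0; case: (msupp p) sp => // m l sp.
by have [|//] := sp m; apply: mem_head.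
Qed.

(** The Koszul complex, obtained by adding one variable at a time: a new variable
    y is a nonzerodivisor modulo the ideal L of the previous ones, so L : y = L
    and L plays both roles in [horseshoe]. *)
Lemma linearly_resolved_variables (Y : {set 'I_n}) :
  linearly_resolved 1 (ideal_gen (variables Y) : polyset K n).
Proof.
pose mons ys : seq 'X_{1..n} := [seq U_(y)%MM | y : 'I_n <- ys].
have resolved ys : uniq ys ->
    linearly_resolved 1 (ideal_gen (monomials (mons ys)) : polyset K n).
  elim/last_ind: ys => [_|ys y IHys].
    exact: linearly_resolved_eqset mon_ideal_nil (linearly_resolved_zero 1).
  rewrite rcons_uniq => /andP[yNys /IHys res_ys].
  have homX: ('X_y : R) \is 1.-homog by rewrite dhomogX /= mdeg1.
  apply: (horseshoe res_ys res_ys homX); last first.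
    by move=> p; rewrite /mons map_rcons; apply: mon_ideal_rcons.
  move=> p; rewrite /colon !mon_idealP; split=> sp k.
    rewrite (perm_mem (msuppMX _ _)) => /mapP[k' /sp[g gs le_gk'] ->].
    by exists g => //; apply: lepm_trans le_gk' (lem_addl _ _).
  move=> kp; have [|g] := sp (U_(y) + k)%MM.
    by rewrite (perm_mem (msuppMX _ _)) map_f.
  move=> /mapP[y' y'ys ->]; rewrite lep1mP mnmDE mnm1E => le_k.
  exists U_(y')%MM; first by rewrite map_f.
  by move: le_k; rewrite lep1mP; case: (eqVneq y y') yNys => // ->; rewrite y'ys.
apply: linearly_resolved_eqset (resolved (enum Y) (enum_uniq _)) => p.
split=> -[l lP ->]; exists l => // c /lP[].
  by move=> _ /mapP[y yY ->] ->; exists y; rewrite // -mem_enum.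
by move=> y yY ->; exists U_(y)%MM; rewrite // map_f // mem_enum.
Qed.

(** Adding the monomials in the given order, each colon ideal is generated by
    variables and therefore linearly resolved. *)
Lemma linearly_resolved_lq d (s : seq 'X_{1..n}) :
    lq_order s -> (forall m, m \in s -> mdeg m = d) ->
  linearly_resolved d (ideal_gen (monomials s) : polyset K n).
Proof.
elim/last_ind: s => [_ _|s m IHs].
  exact: linearly_resolved_eqset mon_ideal_nil (linearly_resolved_zero d).
rewrite lq_order_rcons => -[lqs /(colon_linear K)[Y eqY]] deg_s.
have res_s: linearly_resolved d (ideal_gen (monomials s) : polyset K n).
  by apply: IHs => // m' m's; apply: deg_s; rewrite mem_rcons inE m's orbT.
have homX: ('X_[m] : R) \is d.-homog.
  by rewrite dhomogX /= deg_s // mem_rcons mem_head.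
apply: (horseshoe res_s (linearly_resolved_variables Y) homX).
  exact: eqset_sym.
exact: mon_ideal_rcons.
Qed.

End LinearResolutions.

(** * Consequences of a vertex splitting *)

Section VertexSplittable.
Variables (K : fieldType) (n : nat).
Local Notation R := {mpoly K[n]}.
Implicit Types (I J : polyset K n) (G s : seq 'X_{1..n}) (m : 'X_{1..n}).

Lemma lepm_add2l (c a b : 'X_{1..n}) : (c + a <= c + b)%MM = (a <= b)%MM.
Proof. by apply: eq_forallb => i; rewrite !mnmDE leq_add2l. Qed.

Lemma proper_divisor (a b : 'X_{1..n}) : (a <= b)%MM -> a != b ->
  exists2 z, (a <= b - U_(z))%MM & (U_(z) <= b)%MM.
Proof.
move=> /mnm_lepP le_ab neq_ab; case: (pickP (fun z => (a z < b z)%N)) => [z lt_z|].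
  exists z; last by rewrite lep1mP -lt0n; apply: leq_ltn_trans lt_z.
  apply/mnm_lepP => i; rewrite mnmBE mnm1E; case: eqP => [<-|_].
    by rewrite leq_subRL ?addn1 ?add1n // (leq_ltn_trans _ lt_z).
  by rewrite subn0.
move=> none; case/eqP: neq_ab; apply/mnmP => i; apply/eqP.
by rewrite eqn_leq le_ab leqNgt none.
Qed.

Lemma scale_mon_ideal (x : 'I_n) G :
  eqset (scale_ideal 'X_x (ideal_gen (monomials G)) : polyset K n)
        (ideal_gen (monomials [seq (U_(x) + m)%MM | m <- G])).
Proof.
move=> p; split=> [[q /mon_idealP Gq ->]|[l lP ->]].
  apply/mon_idealP => k; rewrite mulrC (perm_mem (msuppMX _ _)).
  move=> /mapP[k' /Gq[g gG le_g] ->]; exists (U_(x) + g)%MM.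
    by rewrite map_f.
  by rewrite lepm_add2l.
elim: l lP => [|c l IHl] lP.
  by exists 0; rewrite ?big_nil ?mulr0 //; apply: ideal_gen0.
have [|q Gq lE] := IHl.
  by move=> c' c'l; apply: lP; rewrite inE c'l orbT.
have [_ /mapP[g gG ->] cE] := lP c (mem_head _ _).
exists (c.1 * 'X_[g] + q).
  by apply: ideal_genD => //; apply: ideal_genM; apply: ideal_gen_incl; exists g.
by rewrite big_cons lE cE mpolyXD mulrDr mulrCA.
Qed.

Lemma min_mon_gens_scale (x : 'I_n) I G :
  min_mon_gens I G ->
  min_mon_gens (scale_ideal 'X_x I) [seq (U_(x) + m)%MM | m <- G].
Proof.
move=> /min_mon_gensP[uG IG acG]; apply/min_mon_gensP; split.
- by rewrite map_inj_uniq // => a b /eqP; rewrite eqm_add2l => /eqP.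
- move=> p; rewrite -scale_mon_ideal.
  by split=> -[q /IG Iq ->]; exists q.
- move=> _ _ /mapP[a aG ->] /mapP[b bG ->]; rewrite lepm_add2l => le_ab.
  by rewrite (acG _ _ aG bG le_ab).
Qed.

(** Linear quotients for every component of the ideal generated by G; the
    monomials involve all variables, also those not occurring in G. *)
Definition componentwise_lq G := forall d, exists2 s, lq_order s &
  forall m, m \in s <-> mdeg m = d /\ exists2 g, g \in G & (g <= m)%MM.

Lemma componentwise_lq_single m : componentwise_lq [:: m].
Proof.
move=> d; case: (leqP (mdeg m) d) => [le_d|lt_d].
  exists [seq (m + k)%MM | k <- monomials_of_degree n (d - mdeg m)].
    by apply: lq_order_map; apply: lq_order_monomials_of_degree.
  move=> k; split=> [/mapP[k']|[deg_k [_ /[!inE] /eqP -> le_mk]]].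
    rewrite mem_monomials_of_degree => /eqP deg_k' ->.
    rewrite mdegD deg_k' subnKC //; split=> //.
    by exists m; rewrite ?mem_head ?lem_addr.
  apply/mapP; exists (k - m)%MM; last by rewrite addmC submK.
  by rewrite mem_monomials_of_degree -deg_k -{2}(submK le_mk) mdegD addnK.
exists [::] => // k; split=> // -[deg_k [_ /[!inE] /eqP ->]] le_mk.
move: lt_d; rewrite -deg_k -(submK le_mk) mdegD.
by rewrite ltnNge leq_addl.
Qed.

Lemma antichain_single m : antichain [:: m].
Proof. by move=> a b /[!inE] /eqP -> /eqP ->. Qed.

Lemma mon_ideal_single m :
  eqset (ideal_gen (eq 'X_[m])) (ideal_gen (monomials [:: m]) : polyset K n).
Proof.
move=> p; split=> -[l lP ->]; exists l => // c /lP.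
  by move=> <-; exists m; rewrite ?mem_head.
by move=> [_ /[!inE] /eqP -> ->].
Qed.

(** The induction over vertex splittings.  In the step, both lists have the form
    s1, s2 with the elements of s1 divisible by x and those of s2 free of x.
    Colons inside s1 or s2 are linear by induction, and all quotients of an
    element of s1 by the gcd with an element v of s2 are divisible by x, so it
    suffices that x itself is in the colon, that is, that an element of s1
    divides x * v.  For generators this is the inclusion of I2 in I1.  For
    monomials of degree d one needs a monomial of degree d - 1 of I1 dividing
    v; it exists unless v is a minimal generator of I1, and then x * v would be
    a generator of I divisible by a generator of I2. *)
Lemma vertex_splittable_gens X I :
  vertex_splittable X I -> exists u,
    [/\ min_mon_gens I u, lq_order u, componentwise_lq u
      & forall m, m \in u -> forall y, m y != 0%N -> y \in X].
Proof.
have single (Y : {set _}) J m : (forall x, m x != 0%N -> x \in Y) ->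
    eqset J (ideal_gen (eq 'X_[m])) -> exists u,
      [/\ min_mon_gens J u, lq_order u, componentwise_lq u
        & forall m, m \in u -> forall y, m y != 0%N -> y \in Y].
  move=> mY JE; exists [:: m]; split=> [|||_ /[!inE] /eqP -> //].
  - apply/min_mon_gensP; split=> //; last exact: antichain_single.
    exact: eqset_trans JE (mon_ideal_single m).
  - by move=> [|//] _ m'.
  - exact: componentwise_lq_single.
elim=> {X I} [X I m mX IE|X I IE|X I IE|
  X I x I1 I2 G1 G2 xX _ IH1 _ IH2 IE I21 minG1 minG2 minG].
- exact: single mX IE.
- exists [::]; split=> //.
    apply/min_mon_gensP; split=> //; exact: eqset_trans IE (@mon_ideal_nil K n).
  by move=> d; exists [::] => // m; split=> // -[_ []].
- apply: (single X I 0%MM) => [y|p]; first by rewrite mnm0E.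
  rewrite IE; split=> // _; rewrite -[p]mulr1 -mpolyX0.
  by apply: ideal_genM; apply: ideal_gen_incl.
have [u1 [min1 lq1 clq1 sup1]] := IH1; have [u2 [min2 lq2 clq2 sup2]] := IH2.
set xu1 := [seq (U_(x) + m)%MM | m <- u1]; pose u := xu1 ++ u2.
have eqG1: G1 =i xu1.
  exact: min_mon_gens_unique minG1 (min_mon_gens_scale x min1).
have eqG2: G2 =i u2 by apply: min_mon_gens_unique minG2 min2.
have eqG: G1 ++ G2 =i u by move=> m; rewrite !mem_cat eqG1 eqG2.
have [_ I1E _] := (min_mon_gensP I1 u1).1 min1.
have [_ I2E _] := (min_mon_gensP I2 u2).1 min2.
have free m : m \in u2 -> m x = 0%N.
  by move=> /sup2 m2; apply/eqP; apply/negPn/negP => /m2; rewrite !inE eqxx.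
have xu1_gt0 m : m \in xu1 -> (0 < m x)%N.
  by move=> /mapP[k _ ->]; rewrite mnmDE mnm1E eqxx.
have u21 m : (exists2 g, g \in u2 & (g <= m)%MM) -> exists2 g, g \in u1 & (g <= m)%MM.
  by move=> /(mon_idealX K)/I2E/I21/I1E/mon_idealX.
have lq_u: lq_order u.
  apply: lq_order_cat => [||m mu2]; [exact: lq_order_map | by [] |].
  move=> m' /xu1_gt0 m'x; have [|g gu1 le_gm] := u21 m; first by exists m.
  exists (U_(x) + g)%MM, x; split; first by rewrite map_f.
    by rewrite [X in (_ <= X)%MM]addmC lepm_add2l.
  by rewrite free.
have ac_u: antichain u.
  have [_ _ acG] := (min_mon_gensP I (G1 ++ G2)).1 minG.
  by move=> a b; rewrite -!eqG; apply: acG.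
exists u; split=> //.
- apply/min_mon_gensP; split=> //; first exact: lq_order_uniq.
  have [_ GE _] := (min_mon_gensP I (G1 ++ G2)).1 minG.
  exact: eqset_trans GE (@eq_mon_ideal K n _ _ eqG).
- move=> d.
  have [s2 lqs2 s2E] := clq2 d.
  pose t2 := [seq m : 'X_{1..n} <- s2 | m x == 0%N].
  have [s1 lqs1 s1E] : exists2 s1, lq_order s1 & forall m, m \in s1 <->
      (mdeg m).+1 = d /\ exists2 g, g \in u1 & (g <= m)%MM.
    case: d {s2 lqs2 s2E t2} => [|d]; first by exists [::] => // m; split=> // -[].
    by have [s1 lqs1 s1E] := clq1 d; exists s1 => // m; rewrite s1E; split=> -[] [->].
  exists ([seq (U_(x) + m)%MM | m <- s1] ++ t2).
    apply: lq_order_cat => [||v]; [exact: lq_order_map | exact: lq_order_filter_free |].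
    rewrite mem_filter => /andP[/eqP vx0 /s2E[deg_v [g2 g2u2 le_g2v]]].
    have [|g1 g1u1 le_g1v] := u21 v; first by exists g2.
    have neq_g1v: g1 != v.
      apply/eqP => eq_g1v.
      have: g2 = (U_(x) + g1)%MM.
        apply: ac_u; rewrite ?mem_cat ?g2u2 ?map_f ?orbT //.
        by rewrite eq_g1v; apply: lepm_trans le_g2v (lem_addl _ _).
      by move/mnmP/(_ x); rewrite free // mnmDE mnm1E eqxx.
    have [z le_g1 le_z] := proper_divisor le_g1v neq_g1v.
    move=> _ /mapP[k _ ->]; exists (U_(x) + (v - U_(z)))%MM, x; split.
    + apply: map_f; apply/s1E; split; last by exists g1.
      by rewrite -deg_v -{2}(submK le_z) mdegD mdeg1 addn1.
    + by rewrite [X in (_ <= X)%MM]addmC lepm_add2l lem_subr.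
    + by rewrite vx0 mnmDE mnm1E eqxx.
  move=> m; rewrite mem_cat; have [mx0|mx] := posnP (m x).
    have -> : (m \in [seq (U_(x) + m)%MM | m <- s1]) = false.
      by apply/mapP => -[k _ mE]; move: mx0; rewrite mE mnmDE mnm1E eqxx.
    rewrite mem_filter mx0 eqxx /= s2E; split=> -[-> [g gu le_gm]]; split=> //.
      by exists g; rewrite // mem_cat gu orbT.
    move: gu; rewrite mem_cat => /orP[/xu1_gt0|gu2]; last by exists g.
    by move/mnm_lepP/(_ x): le_gm; rewrite mx0 leqn0 => /eqP ->.
  rewrite mem_filter gtn_eqF //= orbF.
  have le_xm: (U_(x) <= m)%MM by rewrite lep1mP -lt0n.
  have -> : m = (U_(x) + (m - U_(x)))%MM by rewrite addmC submK.
  move: (m - U_(x))%MM => {mx le_xm} {}m.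
  rewrite mem_map => [|a b /eqP]; last by rewrite eqm_add2l => /eqP.
  rewrite s1E mdegD mdeg1 add1n; split=> -[-> [g gu le_gm]]; split=> //.
    exists (U_(x) + g)%MM; last by rewrite lepm_add2l.
    by rewrite mem_cat map_f.
  move: gu le_gm; rewrite mem_cat => /orP[/mapP[g1 g1u1 ->]|gu2].
    by rewrite lepm_add2l => le_g1; exists g1.
  move=> /mnm_lepP le_g; apply: u21; exists g => //; apply/mnm_lepP => i.
  have := le_g i; rewrite mnmDE mnm1E.
  by case: eqVneq => [<-|_ //]; rewrite free.
- move=> m; rewrite mem_cat => /orP[/mapP[k ku1 ->]|/sup2 m2] y.
    rewrite mnmDE mnm1E; case: (eqVneq x y) => [<- //|_]; rewrite add0n => ky.
    by have := sup1 k ku1 y ky; rewrite !inE => /andP[].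
  by move=> /m2; rewrite !inE => /andP[].
Qed.

Lemma vertex_splittable_linear_quotients X I :
  vertex_splittable X I -> linear_quotients I.
Proof.
by move=> /vertex_splittable_gens[u [? ? _ _]]; apply/linear_quotientsP; exists u.
Qed.

Lemma vertex_splittable_componentwise_linear X I :
  vertex_splittable X I -> componentwise_linear I.
Proof.
move=> /vertex_splittable_gens[u [/min_mon_gensP[_ IE _] _ clq _]] d.
have [s lqs sE] := clq d.
apply: linearly_resolved_regularity.
have : linearly_resolved d (ideal_gen (monomials s) : polyset K n).
  by apply: linearly_resolved_lq => // m /sE[].
apply: linearly_resolved_eqset => p; split=> [|[l lP ->]].
  move=> [l lP ->]; exists l => // c /lP[m /sE[deg_m um] ->].
  by split; [apply/IE/mon_idealX | rewrite dhomogX /= deg_m].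
apply: ideal_gen_sum => c /lP[Ic2 /dhomogP hc2]; apply: ideal_genM.
apply/mon_idealP => m mc2; exists m => //; apply/sE; split; first exact: hc2.
by have /IE/mon_idealP := Ic2; apply.
Qed.

End VertexSplittable.

(** * An exchange property from linear quotients and from linear syzygies *)

Section FirstSyzygies.
Variables (K : fieldType) (n : nat).
Local Notation R := {mpoly K[n]}.
Implicit Types (I J : polyset K n) (G s : seq 'X_{1..n}) (m u v : 'X_{1..n}).
Implicit Types (p q : R).

(** Moving from v towards u by one variable: the trace left on the generators by
    a linear syzygy that involves v. *)
Definition exchange G u v := exists g a,
  [/\ g \in G, g != v, (g <= v + U_(a))%MM & (v a < u a)%N].

(** The generator that comes later in the order with linear quotients plays the
    role of v. *)
Lemma linear_quotients_exchange I G u v :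
    linear_quotients I -> min_mon_gens I G -> u \in G -> v \in G -> u != v ->
  exchange G u v \/ exchange G v u.
Proof.
move=> /linear_quotientsP[s minI lqs] minG uG vG neq_uv.
have eqG := min_mon_gens_unique minG minI.
have [us _ _] := minI.
have exch i j : (i < j < size s)%N -> exchange G (nth 0%MM s i) (nth 0%MM s j).
  move=> /andP[lt_ij lt_j].
  have [|g [a [gs le_g lt_a]]] := lqs j lt_j (nth 0%MM s i).
    by rewrite -(nth_take _ lt_ij) mem_nth // size_take lt_j.
  exists g, a; split=> //; first by rewrite eqG; apply: mem_take gs.
  apply/eqP => eq_g; have: uniq (take j.+1 s) by apply: take_uniq.
  by rewrite (take_nth 0%MM lt_j) rcons_uniq -eq_g gs.
move: uG vG; rewrite !eqG => us' vs'.
have := exch (index u s) (index v s); have := exch (index v s) (index u s).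
rewrite !index_mem us' vs' !andbT !nth_index //.
case: (ltngtP (index u s) (index v s)) => [_ _ /(_ isT)|_ /(_ isT)|eq_i _ _];
  [by left | by right |].
by case/eqP: neq_uv; rewrite -(nth_index 0%MM us') -(nth_index 0%MM vs') eq_i.
Qed.

Lemma monomial_between (a b : 'X_{1..n}) d :
    (a <= b)%MM -> (mdeg a <= d <= mdeg b)%N ->
  exists m, [/\ (a <= m)%MM, (m <= b)%MM & mdeg m = d].
Proof.
move=> le_ab /andP[le_ad]; move: {2}(mdeg b - d)%N (erefl (mdeg b - d)%N) => k.
elim: k b le_ab => [|k IHk] b le_ab eq_k le_db.
  exists b; split=> //; apply/eqP; rewrite eqn_leq le_db andbT.
  by rewrite -subn_eq0 eq_k.
have lt_db: (d < mdeg b)%N by rewrite -subn_gt0 eq_k.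
have [|z le_az le_z] := proper_divisor le_ab.
  by apply: contraTneq lt_db => <-; rewrite -leqNgt.
have eq_b: (mdeg (b - U_(z))).+1 = mdeg b.
  by rewrite -{2}(submK le_z) mdegD mdeg1 addn1.
have [|||m [le_am le_mb deg_m]] := IHk (b - U_(z))%MM => //.
- by apply: succn_inj; rewrite -eq_k -eq_b subSn // -ltnS eq_b.
- by rewrite -ltnS eq_b.
by exists m; split=> //; apply: lepm_trans le_mb (lem_subr _ _).
Qed.

(** Only the constant term of p can contribute in the degree of q. *)
Lemma mcoeffM_homog0 d p q m : q \is d.-homog -> mdeg m = d ->
  (p * q)@_m = p@_0 * q@_m.
Proof.
move=> /dhomogP hq deg_m; rewrite -[p in LHS](subrK (p@_0)%:MP) mulrDl mcoeffD.
rewrite mcoeffCM memN_msupp_eq0 ?add0r //; apply/negP.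
move=> /msuppM_le/allpairsP[[m1 m2] /= [m1p m2q mE]].
have m10: m1 = 0%MM.
  apply/eqP; rewrite -mdeg_eq0 -(eqn_add2r (mdeg m2)) -mdegD -mE deg_m.
  by rewrite add0n -(hq _ m2q).
by move: m1p; rewrite m10 mcoeff_msupp mcoeffB mcoeffC eqxx mulr1 subrr eqxx.
Qed.

(** The coefficient of the product at a monomial M sums the contributions of the
    M / b over the variables b; the hypothesis excludes all but b = a. *)
Lemma mcoeffM_homog1 p q m a : p \is 1.-homog ->
    (forall b k, b != a -> (m + U_(a) = U_(b) + k)%MM -> q@_k = 0) ->
  (p * q)@_(m + U_(a)) = p@_U_(a) * q@_m.
Proof.
move=> hp q0; rewrite -[p in LHS](subrK (p@_U_(a) *: 'X_a)) mulrDl mcoeffD.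
rewrite -scalerAl mcoeffZ ['X_a * q]mulrC addmC mcoeffMX.
rewrite memN_msupp_eq0 ?add0r //; apply/negP.
move=> /msuppM_le/allpairsP[[m1 m2] /= [m1p m2q mE]].
have h1: p - p@_U_(a) *: 'X_a \is 1.-homog.
  by rewrite rpredB // rpredZ // dhomogX /= mdeg1.
have /mdeg1P[b /eqP m1E]: mdeg m1 == 1%N by rewrite (dhomog_mf h1 m1p).
have neq_ba: b != a.
  apply: contraTneq m1p => eq_ba.
  by rewrite mcoeff_msupp m1E eq_ba mcoeffB mcoeffZ mcoeffXU eqxx mulr1 subrr eqxx.
move: m2q; rewrite mcoeff_msupp (q0 b) ?eqxx //.
by rewrite -m1E -mE addmC.
Qed.

(** Suppose that there is no exchange.  If a divides u more often than v, then v
    is the only monomial of degree d of the ideal dividing v * a.  So in the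
    coefficient of v * a of a linear syzygy only the monomial v contributes, and
    the linear form [eps k] obtained by replacing each generator with its
    coefficient at v has no term in such variables a.  These are the variables
    of w / v, hence no multiple of [eps k] has a term w / v; this is [phi0].
    But u' and v have a syzygy which [phi] maps to 1. *)
Lemma componentwise_linear_exchange I G u v :
    componentwise_linear I -> eqset I (ideal_gen (monomials G)) -> antichain G ->
    u \in G -> v \in G -> u != v -> (mdeg u <= mdeg v)%N ->
  exchange G u v.
Proof.
move=> linI IG acG uG vG neq_uv le_uv; set d := mdeg v.
case: (boolP (has (fun g => (g != v) &&
    [exists a, (g <= v + U_(a))%MM && (v a < u a)%N]) G)) => [/hasP[g gG]|].
  by case/andP=> neq_g /existsP[a /andP[le_g lt_a]]; exists g, a.
move/hasPn => none; exfalso.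
pose w := mlcm u v.
have [u' [le_uu' le_u'w deg_u']]:
    exists m, [/\ (u <= m)%MM, (m <= w)%MM & mdeg m = d].
  apply: monomial_between; first exact: lem_mlcml.
  rewrite le_uv -{1}(submK (lem_mlcmr u v : (v <= w)%MM)) mdegD.
  by rewrite leq_addl.
have neq_u'v: u' != v.
  by apply: contraNneq neq_uv => eq_u'; apply/eqP/acG; rewrite // -eq_u'.
pose J := component I d.
have JX m g : mdeg m = d -> g \in G -> (g <= m)%MM -> J 'X_[m].
  move=> deg_m gG le_g; apply: ideal_gen_incl; split.
    by apply/IG/mon_idealX; exists g.
  by rewrite dhomogX /= deg_m.
have JS p m : J p -> m \in msupp p ->
    (d <= mdeg m)%N /\ exists2 g, g \in G & (g <= m)%MM.
  move=> [l lP ->] /msupp_sum_le /flatten_mapP[c].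
  rewrite mem_filter => /andP[_ /lP[/IG/mon_idealP Gc /dhomogP hc]].
  move=> /msuppM_le/allpairsP[[m1 m2] /= [_ m2c ->]]; split.
    by rewrite mdegD -(hc _ m2c) leq_addl.
  have [g gG le_g] := Gc _ m2c; exists g => //.
  by apply: lepm_trans le_g (lem_addl _ _).
have [/(_ 'X_[v])[J0 _]|] := linI d; last move=>
  [F [[[hom_aug hom_diff] [augE ker_aug _] minF] _ regF]].
  have /J0/esym/eqP : J 'X_[v] by apply: (JX _ v).
  by rewrite -msupp_eq0 msuppX.
have shift_le i k : (@shift K n F i k <= d + i)%N.
  apply: regF; rewrite /betti -lt0n; apply/card_gt0P; exists k.
  by rewrite inE.
pose al l := aug F l 0.
have Jal l : J (al l).
  by apply/augE; exists (delta_mx 0 l); rewrite -rowE mxE.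
(* A generator of degree less than d would be zero, since the ideal starts in
   degree d; its basis vector would be a syzygy, hence by exactness lie
   in the image of a matrix whose entries have no constant term. *)
have shift0 l : @shift K n F 0 l = d.
  apply/eqP; rewrite eqn_leq -{1}[d]addn0 shift_le /= leqNgt; apply/negP => lt_d.
  have al0: al l = 0.
    apply/eqP; rewrite -msupp_eq0; case E: (msupp (al l)) => [//|m s].
    have ms: m \in msupp (al l) by rewrite E mem_head.
    have [le_d _] := JS _ _ (Jal l) ms.
    by move: lt_d; rewrite -(dhomog_mf (hom_aug l) ms) /= ltnNge le_d.
  have [|t tE] := (ker_aug (delta_mx 0 l)).1.
    by rewrite -rowE; apply/rowP => j; rewrite (ord1 j) !mxE -[RHS]al0.
  have /eqP := congr1 (mcoeff 0%MM) (congr1 (fun A : 'rV_(rank F 0) => A 0 l) tE).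
  rewrite !mxE !eqxx mcoeff1 eqxx raddf_sum big1 ?oner_eq0 // => k _ /=.
  by rewrite rmorphM /= minF mulr0.
have hom_al l : al l \is d.-homog by rewrite -(shift0 l); apply: hom_aug.
(* Regularity bounds the degree of a syzygy by d + 1, and minimality excludes
   entries of degree 0. *)
have hom1 k l : diff F 0 k l \is 1.-homog.
  have := hom_diff 0%N k l; have := shift_le 1%N k.
  rewrite /homog_sub shift0 addn1.
  case: (leqP d (@shift K n F 1 k)) => [le_d|_ _ ->]; last exact: rpred0.
  rewrite leq_eqVlt => /predU1P[->|]; first by rewrite subSn // subnn.
  rewrite ltnS => ge_d; have -> : (@shift K n F 1 k - d = 0)%N.
    by apply/eqP; rewrite subn_eq0.
  move=> /dhomogP h0; apply/dhomogP => m mp.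
  have /eqP := h0 m mp; rewrite /= mdeg_eq0 => /eqP m0.
  by move: mp; rewrite m0 mcoeff_msupp minF eqxx.
have diff_aug k : \sum_l diff F 0 k l * al l = 0.
  have /rowP/(_ 0) : row k (diff F 0) *m aug F = 0.
    by apply/ker_aug; exists (delta_mx 0 k); rewrite -rowE.
  rewrite [RHS]mxE => sum0; rewrite -[RHS]sum0 mxE.
  by apply: eq_bigr => l _; rewrite mxE.
pose eps k := \sum_l (al l)@_v *: diff F 0 k l.
have hom_eps k : eps k \is 1.-homog.
  by rewrite rpred_sum // => l _; apply: rpredZ.
have eps0 k a : (v a < u a)%N -> (eps k)@_U_(a) = 0.
  move=> lt_a; have /(congr1 (mcoeff (v + U_(a))%MM)) := diff_aug k.
  rewrite mcoeff0 => sum0; rewrite -[RHS]sum0 !raddf_sum; apply: eq_bigr => l _ /=.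
  rewrite mcoeffZ mulrC; apply/esym/mcoeffM_homog1 => [|b m neq_ba mE].
    exact: hom1.
  apply/eqP; rewrite mcoeff_eq0; apply/negP => /(JS _ _ (Jal l))[_ [g gG le_g]].
  have := none g gG; rewrite negb_and negbK negb_exists => /orP[/eqP eq_g|].
    have /mnmP/(_ b) := mE; rewrite !mnmDE !mnm1E eqxx eq_sym (negPf neq_ba) addn0.
    by move=> vE; have /mnm_lepP/(_ b) := le_g; rewrite eq_g vE ltnn.
  move=> /forallP/(_ a); rewrite lt_a andbT mE => /negP; apply.
  by apply: lepm_trans le_g (lem_addl _ _).
pose phi (c : 'rV[R]_(rank F 0)) := \sum_l (al l)@_v * (c 0 l)@_(w - v).
have phi0 t : phi (t *m diff F 0) = 0.
  have -> : phi (t *m diff F 0) = \sum_k (t 0 k * eps k)@_(w - v).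
    rewrite /phi; transitivity
      (\sum_l \sum_k (t 0 k * ((al l)@_v *: diff F 0 k l))@_(w - v)).
      apply: eq_bigr => l _; rewrite mxE raddf_sum mulr_sumr /=.
      by apply: eq_bigr => k _; rewrite -scalerAr mcoeffZ.
    rewrite exchange_big; apply: eq_bigr => k _ /=.
    by rewrite mulr_sumr raddf_sum.
  apply: big1 => k _; apply/eqP; rewrite mcoeff_eq0; apply/negP.
  move=> /msuppM_le/allpairsP[[m1 m2] /= [_ m2e wE]].
  have /mdeg1P[a /eqP m2E]: mdeg m2 == 1%N by rewrite (dhomog_mf (hom_eps k) m2e).
  move: m2e; rewrite m2E mcoeff_msupp eps0 ?eqxx //.
  have /mnmP/(_ a) := wE; rewrite m2E mnmBE !mnmDE mnm1E eqxx addn1 /w mnmE.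
  by case: (ltnP (v a) (u a)) => // le; rewrite subnn.
have [a aE] := (augE 'X_[v]).1 (JX v v (erefl _) vG (lepm_refl _)).
have [b bE] := (augE 'X_[u']).1 (JX u' u deg_u' uG le_uu').
have le_vw: (v <= w)%MM by apply: lem_mlcmr.
have [|t tE] := (ker_aug ('X_[w - v] *: a - 'X_[w - u'] *: b)).1.
  rewrite mulmxBl -!scalemxAl; apply/rowP => j; rewrite (ord1 j).
  have entry (x y : R) (A B : 'M[R]_1) :
    (x *: A - y *: B) 0 0 = x * A 0 0 - y * B 0 0 by rewrite !mxE.
  rewrite entry [RHS]mxE.
  by rewrite -aE -bE -!mpolyXD !submK // subrr.
have := phi0 t; rewrite -tE /phi => /eqP.
rewrite (eq_bigr (fun l => (a 0 l)@_0 * (al l)@_v)) => [|l _].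
  have := congr1 (mcoeff v) aE; rewrite mxE raddf_sum /= mcoeffX eqxx.
  rewrite (eq_bigr (fun l => (a 0 l)@_0 * (al l)@_v)) => [<-|l _].
    by rewrite oner_eq0.
  exact: mcoeffM_homog0 (hom_al l) (erefl _).
rewrite mulrC !mxE mcoeffB mulrC.
have -> : ('X_[w - v] * a 0 l)@_(w - v) = (a 0 l)@_0.
  by rewrite mulrC -{1}[(w - v)%MM]addm0 mcoeffMX.
suff -> : ('X_[w - u'] * b 0 l)@_(w - v) = 0 by rewrite subr0 mulrC.
apply/memN_msupp_eq0; rewrite mulrC (perm_mem (msuppMX _ _)).
apply/mapP => -[k _ wE].
(* Both w / v and w / u' have degree deg w - d. *)
have k0: k = 0%MM.
  apply/eqP; rewrite -mdeg_eq0 -(eqn_add2l (mdeg (w - u'))) -mdegD -wE addn0.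
  by rewrite -(eqn_add2r d) -{2}deg_u' -/d -!mdegD !submK.
have wE' : (w - v = w - u')%MM by rewrite wE k0 addm0.
case/eqP: neq_u'v; apply: (@addmI _ (w - v)%MM).
by rewrite {1}wE' !submK.
Qed.

End FirstSyzygies.

(** * Constructing vertex splittings *)

Section Splitting.
Variables (K : fieldType) (n : nat).
Implicit Types (I J : polyset K n) (G : seq 'X_{1..n}) (X : {set 'I_n}).

Lemma vertex_splittable_eqset X I J :
  eqset I J -> vertex_splittable X I -> vertex_splittable X J.
Proof.
move=> IJ VI; case: {X I} VI IJ => [Y I v vY IE|Y I IE|Y I IE|
  Y I x I1 I2 G1 G2 xY V1 V2 IE I21 m1 m2 m] IJ;
  have JI := eqset_sym IJ.
- exact: VSplit_monomial vY (eqset_trans JI IE).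
- exact: VSplit_zero (eqset_trans JI IE).
- exact: VSplit_full (eqset_trans JI IE).
- apply: (VSplit_step xY V1 V2 (eqset_trans JI IE) I21 m1 m2).
  have /min_mon_gensP[? GE ?] := m; apply/min_mon_gensP; split=> //.
  exact: eqset_trans JI GE.
Qed.

Lemma mon_ideal_cat G1 G2 :
  eqset (ideal_gen (monomials (G1 ++ G2)) : polyset K n)
        (add_ideal (ideal_gen (monomials G1)) (ideal_gen (monomials G2))).
Proof.
move=> p; split=> [[l lP ->]|[q [r [Gq Gr ->]]]].
  elim: l lP => [|c l IHl] lP.
    by exists 0, 0; rewrite big_nil addr0; split=> //; apply: ideal_gen0.
  have [|q [r [Gq Gr lE]]] := IHl.
    by move=> c' c'l; apply: lP; rewrite inE c'l orbT.
  rewrite big_cons lE; have [g] := lP c (mem_head _ _).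
  have cM (H : seq 'X_{1..n}) :
    g \in H -> ideal_gen (monomials H) (c.1 * 'X_[g] : {mpoly K[n]}).
    by move=> gH; apply: ideal_genM; apply: ideal_gen_incl; exists g.
  rewrite mem_cat => /orP[/cM|/cM] Gc ->.
    by exists (c.1 * 'X_[g] + q), r; split; [apply: ideal_genD | | rewrite addrA].
  by exists q, (c.1 * 'X_[g] + r); split; [| apply: ideal_genD | rewrite addrCA].
apply: ideal_genD; apply/mon_idealP => m.
  by have /mon_idealP Gm := Gq => /Gm[g gG le_g]; exists g; rewrite // mem_cat gG.
by have /mon_idealP Gm := Gr => /Gm[g gG le_g]; exists g; rewrite // mem_cat gG orbT.
Qed.

(** Duplicates are removed here once and for all, so that lists of generators
    need not be shown to be repetition free. *)
Lemma undup_min_mon_gens G : antichain G ->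
  min_mon_gens (ideal_gen (monomials G) : polyset K n) (undup G).
Proof.
move=> acG; apply/min_mon_gensP; split; first exact: undup_uniq.
  by apply: eq_mon_ideal => m; rewrite mem_undup.
by move=> a b; rewrite !mem_undup; apply: acG.
Qed.

Lemma vertex_splittable_step X (x : 'I_n) G1 G2 :
    x \in X -> (forall g, g \in G2 -> g x = 0%N) ->
    (forall g, g \in G2 -> exists2 g1, g1 \in G1 & (g1 <= g)%MM) ->
    antichain ([seq (U_(x) + g)%MM | g <- G1] ++ G2) ->
    vertex_splittable (X :\ x) (ideal_gen (monomials G1) : polyset K n) ->
    vertex_splittable (X :\ x) (ideal_gen (monomials G2) : polyset K n) ->
  vertex_splittable X
    (ideal_gen (monomials ([seq (U_(x) + g)%MM | g <- G1] ++ G2)) : polyset K n).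
Proof.
set G := _ ++ _ => xX free G21 acG V1 V2.
have ac1: antichain G1.
  move=> a b aG bG le_ab.
  have /eqP: (U_(x) + a = U_(x) + b)%MM.
    by apply: acG; rewrite ?mem_cat ?map_f // lepm_add2l.
  by rewrite eqm_add2l => /eqP.
have ac2: antichain G2.
  by move=> a b aG bG; apply: acG; rewrite mem_cat ?aG ?bG orbT.
pose xG1 := [seq (U_(x) + g)%MM | g <- undup G1].
apply: (@VSplit_step _ _ _ _ x _ _ xG1 (undup G2) xX V1 V2).
- move=> p; rewrite mon_ideal_cat; split=> -[q [r [Gq Gr ->]]];
    by exists q, r; split=> //; apply/scale_mon_ideal.
- by move=> p /mon_idealP Gp; apply/mon_idealP => m /Gp[g /G21[g1 g1G le_g1] le_g];
    exists g1 => //; apply: lepm_trans le_g1 le_g.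
- exact/min_mon_gens_scale/undup_min_mon_gens.
- exact: undup_min_mon_gens.
- have eqG: xG1 ++ undup G2 =i G.
    move=> m; rewrite !mem_cat mem_undup; congr (_ || _).
    by apply: eq_mem_map => k; rewrite mem_undup.
  apply/min_mon_gensP; split.
  + rewrite cat_uniq undup_uniq andbT map_inj_uniq ?undup_uniq //=; last first.
      by move=> a b /eqP; rewrite eqm_add2l => /eqP.
    apply/hasPn => g; rewrite mem_undup => /free gx; apply/mapP => -[k _ gE].
    by move: gx; rewrite gE mnmDE mnm1E eqxx.
  + by apply: eq_mon_ideal => m; rewrite eqG.
  + by move=> a b; rewrite !eqG; apply: acG.
Qed.

Lemma antichain_powers (e : 'I_n -> nat) (s : seq 'I_n) :
  (forall y, y \in s -> 0 < e y)%N -> antichain [seq (U_(y) *+ e y)%MM | y <- s].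
Proof.
move=> e_gt0 _ _ /mapP[y ys ->] /mapP[z zs ->] /mnm_lepP/(_ y).
rewrite !mulmnE !mnm1E eqxx mul1n; case: eqP => [-> //|_].
by rewrite mul0n leqNgt e_gt0.
Qed.

(** Split off a variable y occurring with exponent 1: then I1 is the whole ring
    and I2 is generated by the other powers.  What remains in the end is at
    most one power, which is a monomial ideal with a single generator. *)
Lemma vertex_splittable_powers X (e : 'I_n -> nat) (s : seq 'I_n) :
    {subset s <= X} -> uniq s -> (forall y, y \in s -> 0 < e y)%N ->
    {in s &, forall y z, (1 < e y)%N -> (1 < e z)%N -> y = z} ->
  vertex_splittable X
    (ideal_gen (monomials [seq (U_(y) *+ e y)%MM | y <- s]) : polyset K n).
Proof.
move: {2}(size s) (erefl (size s)) => k.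
elim: k X s => [|k IHk] X s => [/size0nil -> _ _ _ _|size_s sX us e_gt0 big1].
  exact: VSplit_zero (eqset_sym (@mon_ideal_nil K n)).
case: (boolP (has (fun y => e y == 1%N) s)) => [/hasP[y ys /eqP ey1]|/hasPn big].
  have sE: s =i y :: rem y s.
    by move=> z; rewrite inE (mem_rem_uniq y us) !inE; case: eqVneq => [->|].
  pose G2 := [seq (U_(z) *+ e z)%MM | z <- rem y s].
  have subs: {subset rem y s <= s} by apply: mem_rem.
  have neq_y z : z \in rem y s -> z != y.
    by rewrite (mem_rem_uniq y us) inE => /andP[].
  have eqG: [seq (U_(y) + g)%MM | g <- [:: 0%MM]] ++ G2
      =i [seq (U_(y) *+ e y)%MM | y <- s].
    move=> m; rewrite (eq_mem_map _ sE) /= !inE ey1 mulm1n addm0.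
    by [].
  apply: (vertex_splittable_eqset (@eq_mon_ideal K n _ _ eqG)).
  apply: vertex_splittable_step.
  - exact: sX.
  - move=> _ /mapP[z /neq_y neq ->].
    by rewrite mulmnE mnm1E (negPf neq) mul0n.
  - move=> g _; exists 0%MM; rewrite ?mem_head //.
    by apply/mnm_lepP => i; rewrite mnm0E.
  - by move=> a b; rewrite !eqG; apply: antichain_powers.
  - apply: VSplit_full => p; split=> // _; apply/mon_idealP => m _.
    by exists 0%MM; rewrite ?mem_head //; apply/mnm_lepP => i; rewrite mnm0E.
  - apply: IHk.
    + by rewrite size_rem // size_s.
    + by move=> z zs; rewrite !inE (neq_y z zs) sX ?subs.
    + exact: rem_uniq.
    + by move=> z /subs/e_gt0.
    + by move=> z z' /subs zs /subs z's; apply: big1.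
have gt1 y : y \in s -> (1 < e y)%N.
  by move=> ys; rewrite ltn_neqAle eq_sym big // e_gt0.
case: s => [|y [|z s]] in size_s sX us e_gt0 big1 big gt1 *; first by [].
  apply: (VSplit_monomial (v := (U_(y) *+ e y)%MM)); last first.
    exact: eqset_sym (@mon_ideal_single K n _).
  move=> x; rewrite mulmnE mnm1E; case: (eqVneq y x) => // <- _.
  by apply: sX; rewrite mem_head.
have yz: y = z by apply: big1; rewrite ?gt1 ?inE ?eqxx ?orbT.
by move: us; rewrite yz /= mem_head.
Qed.

End Splitting.

(** * Generators of edge ideals *)

Section EdgeMonomials.
Variables (n : nat) (D : wograph n).
Implicit Types (X : {set 'I_n}) (x y z : 'I_n).
Local Notation arc := (Defs.arc D).
Local Notation w := (weight D).
Local Notation adj := (underlying D).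

Definition edge_mon x y : 'X_{1..n} := (U_(x) + U_(y) *+ w y)%MM.

Definition edge_mons X : seq 'X_{1..n} :=
  [seq edge_mon e.1 e.2 | e <- enum [pred e : 'I_n * 'I_n |
     [&& arc e.1 e.2, e.1 \in X & e.2 \in X]]].

Lemma edge_monsP X m :
  reflect (exists x y, [/\ arc x y, x \in X, y \in X & m = edge_mon x y])
          (m \in edge_mons X).
Proof.
apply: (iffP mapP) => [[[x y]]|[x [y [xy xX yX ->]]]].
  by rewrite mem_enum inE /= => /and3P[? ? ?] ->; exists x, y.
by exists (x, y); rewrite // mem_enum inE /= xy xX yX.
Qed.

Lemma edge_monE x y z : edge_mon x y z = ((x == z) + (y == z) * w y)%N.
Proof. by rewrite mnmDE mulmnE !mnm1E. Qed.

Lemma arc_neq x y : arc x y -> x != y.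
Proof. by apply: contraTneq => ->; rewrite arc_irr. Qed.

(** An arc is determined by its end points, as no edge has both orientations. *)
Lemma arc_pair x y x' y' : arc x y -> arc x' y' ->
  x \in [:: x'; y'] -> y \in [:: x'; y'] -> x = x' /\ y = y'.
Proof.
rewrite !inE => xy xy' /orP[]/eqP xE /orP[]/eqP yE; move: xy; rewrite xE yE.
- by rewrite arc_irr.
- by [].
- by move=> y'x'; move: (arc_asym y'x'); rewrite xy'.
- by rewrite arc_irr.
Qed.

Lemma edge_mon_supp x y z : (edge_mon x y z != 0%N) = (z \in [:: x; y]).
Proof.
rewrite edge_monE !inE addn_eq0 muln_eq0 -[w y == _]negbK -lt0n weight_gt0 orbF.
by rewrite ![z == _]eq_sym; case: (x == z); case: (y == z).
Qed.

(** Divisibility forces the same support, hence the same arc. *)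
Lemma antichain_edge_mons X : antichain (edge_mons X).
Proof.
move=> _ _ /edge_monsP[x [y [xy _ _ ->]]] /edge_monsP[x' [y' [xy' _ _ ->]]] le.
have supp z : z \in [:: x; y] -> z \in [:: x'; y'].
  rewrite -!edge_mon_supp -!lt0n => lt; apply: leq_trans lt _.
  exact: (mnm_lepP le).
have [||-> ->//] := arc_pair xy xy'; apply: supp; first exact: mem_head.
by rewrite !inE eqxx orbT.
Qed.

Lemma edge_ideal_gens (K : fieldType) :
  eqset (edge_ideal K D) (ideal_gen (monomials (edge_mons setT))).
Proof.
move=> p; split=> -[l lP ->]; exists l => // c /lP.
  move=> [x [y [xy ->]]]; exists (edge_mon x y).
    by apply/edge_monsP; exists x, y; rewrite !inE.
  by rewrite mpolyXD mpolyXn.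
move=> [_ /edge_monsP[x [y [xy _ _ ->]]] ->]; exists x, y; split=> //.
by rewrite mpolyXD mpolyXn.
Qed.

Lemma edge_ideal_min_gens (K : fieldType) :
  min_mon_gens (edge_ideal K D) (undup (edge_mons setT)).
Proof.
have [uG GE acG] := (min_mon_gensP _ _).1
  (undup_min_mon_gens K (@antichain_edge_mons setT)).
apply/min_mon_gensP; split=> //.
exact: eqset_trans (@edge_ideal_gens K) GE.
Qed.

Definition light x y := (arc x y && (w y == 1%N)) || (arc y x && (w x == 1%N)).

(** Some generator divides the product of z with the generator of the arc
    (x, y): the edge from z may enter y with any weight, since the power of y
    is available, but must otherwise be light. *)
Definition attached z x y := [|| light z x, light z y | arc z y].

(** The common consequence of linear quotients and of componentwise linearity. *)
Definition arcs_linked := forall x y x' y',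
    arc x y -> arc x' y' -> (x, y) != (x', y') ->
  (exists z, [/\ z \in [:: x'; y'], z \notin [:: x; y] & attached z x y]) \/
  (exists z, [/\ z \in [:: x; y], z \notin [:: x'; y'] & attached z x' y']).

(** A generator that divides z * x * y^w(y) and is not that of (x, y) must involve
    z, and its other end point is x or y; the exponents then leave exactly the
    cases of [attached]. *)
Lemma exchange_attached x y x' y' :
    arc x y -> arc x' y' ->
    exchange (edge_mons setT) (edge_mon x' y') (edge_mon x y) ->
  exists z, [/\ z \in [:: x'; y'], z \notin [:: x; y] & attached z x y].
Proof.
move=> xy xy' [_ [z [/edge_monsP[p [q [pq _ _ ->]]] neq_g /mnm_lepP le_g lt_z]]].
have z': z \in [:: x'; y'].
  by rewrite -edge_mon_supp -lt0n; apply: leq_ltn_trans lt_z.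
have supp t : t \in [:: p; q] -> t \in [:: x; y; z].
  rewrite -edge_mon_supp -lt0n => lt_t; have := leq_trans lt_t (le_g t).
  rewrite mnmDE mnm1E addn_gt0 lt0n edge_mon_supp !inE lt0b [z == t]eq_sym.
  by rewrite orbA.
have [ps qs]: p \in [:: x; y; z] /\ q \in [:: x; y; z].
  by split; apply: supp; rewrite !inE eqxx ?orbT.
have zNxy: z \notin [:: x; y].
  apply: contra neq_g => zxy.
  have sub t : t \in [:: x; y; z] -> t \in [:: x; y].
    by rewrite !inE orbA => /orP[//|/eqP ->]; move: zxy; rewrite !inE.
  by have [-> ->] := arc_pair pq xy (sub p ps) (sub q qs).
have neq_xy := arc_neq xy.
have [zx zy]: (z == x) = false /\ (z == y) = false.
  by move: zNxy; rewrite !inE => /norP[/negPf -> /negPf ->].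
have yx : (y == x) = false by rewrite eq_sym (negPf neq_xy).
have w1 t : w t = 1%N <-> (w t <= 1)%N.
  by split=> [->//|le1]; apply/eqP; rewrite eqn_leq le1 weight_gt0.
exists z; split=> //; rewrite /attached /light.
have := le_g q; rewrite mnmDE !edge_monE mnm1E eqxx mul1n.
move: ps qs; rewrite !inE => /or3P[]/eqP pE /or3P[]/eqP qE; subst p q.
- by rewrite arc_irr in pq.
- by rewrite eqxx in neq_g.
- rewrite eqxx [x == z]eq_sym [y == z]eq_sym zx zy => /w1 wz.
  by rewrite pq wz orbT.
- by have := arc_asym xy; rewrite pq.
- by rewrite arc_irr in pq.
- rewrite eqxx [x == z]eq_sym [y == z]eq_sym zx zy => /w1 wz.
  by rewrite pq wz !orbT.
- rewrite eqxx zx yx mul0n addn0 => /w1 wx.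
  by rewrite pq wx.
- by rewrite pq !orbT.
- by rewrite arc_irr in pq.
Qed.

Lemma edge_mon_inj x y x' y' : arc x y -> arc x' y' ->
  edge_mon x y = edge_mon x' y' -> (x, y) = (x', y').
Proof.
move=> xy xy' eq_e; have [||] := arc_pair xy xy'.
- by rewrite -edge_mon_supp -eq_e edge_mon_supp mem_head.
- by rewrite -edge_mon_supp -eq_e edge_mon_supp !inE eqxx orbT.
- by move=> -> ->.
Qed.

Lemma linear_quotients_arcs_linked (K : fieldType) :
  linear_quotients (edge_ideal K D) -> arcs_linked.
Proof.
move=> lqI x y x' y' xy xy' neq.
have memE u v : arc u v -> edge_mon u v \in undup (edge_mons setT).
  by move=> uv; rewrite mem_undup; apply/edge_monsP; exists u, v; rewrite !inE.
have undupE u v :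
    exchange (undup (edge_mons setT)) u v -> exchange (edge_mons setT) u v.
  by move=> [g [a [gG ? ? ?]]]; exists g, a; rewrite mem_undup in gG.
have [|/undupE/exchange_attached|/undupE/exchange_attached] :=
  linear_quotients_exchange lqI (@edge_ideal_min_gens K) (memE _ _ xy) (memE _ _ xy').
- by apply: contra neq => /eqP /(edge_mon_inj xy xy') ->.
- by move=> H; right; apply: H.
- by move=> H; left; apply: H.
Qed.

Lemma componentwise_linear_arcs_linked (K : fieldType) :
  componentwise_linear (edge_ideal K D) -> arcs_linked.
Proof.
move=> linI x y x' y' xy xy' neq.
have memE u v : arc u v -> edge_mon u v \in edge_mons setT.
  by move=> uv; apply/edge_monsP; exists u, v; rewrite !inE.
have neq_e : edge_mon x y != edge_mon x' y'.
  by apply: contra neq => /eqP /(edge_mon_inj xy xy') ->.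
have exch := componentwise_linear_exchange
  linI (@edge_ideal_gens K) (@antichain_edge_mons _).
case: (leqP (mdeg (edge_mon x y)) (mdeg (edge_mon x' y'))) => [le|/ltnW le].
  by right; apply: exchange_attached => //; apply: exch; rewrite ?memE.
by left; apply: exchange_attached => //; apply: exch; rewrite ?memE // eq_sym.
Qed.

End EdgeMonomials.

(** * Bipartite graphs with linked arcs *)

Section BipartiteGraphs.
Variables (n : nat) (D : wograph n) (A : {set 'I_n}).
Implicit Types (X : {set 'I_n}) (a b c d v x y z h : 'I_n).
Local Notation arc := (Defs.arc D).
Local Notation w := (weight D).
Local Notation adj := (underlying D).
Local Notation light := (light D).
Hypothesis sideP : forall x y, adj x y -> (x \in A) != (y \in A).
Hypothesis linked : arcs_linked D.

Lemma arc_adj x y : arc x y -> adj x y.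
Proof. by rewrite /underlying => ->. Qed.

Lemma light_adj x y : light x y -> adj x y.
Proof. by rewrite /underlying => /orP[]/andP[-> _]; rewrite ?orbT. Qed.

Lemma adjC x y : adj x y = adj y x.
Proof. exact: orbC. Qed.

Lemma lightC x y : light x y = light y x.
Proof. exact: orbC. Qed.

Lemma arcN x y : arc x y -> arc y x = false.
Proof. by move=> /arc_asym/negPf. Qed.

Lemma same_side x y : (x \in A) = (y \in A) -> adj x y = false.
Proof. by move=> xy; apply/negP => /sideP; rewrite xy eqxx. Qed.

Lemma opposite_sides a b c d :
  adj a b -> adj c d -> (a \in A) = (c \in A) -> (b \in A) = (d \in A).
Proof.
move=> /sideP + /sideP + ac; rewrite ac.
by case: (c \in A); case: (b \in A); case: (d \in A).
Qed.

Lemma light_arc x y : light x y -> arc x y -> w y = 1%N.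
Proof. by move=> /orP[]/andP[xy /eqP //]; move=> _ /arcN; rewrite xy. Qed.

(** Otherwise one of the two arcs, say (x, z), is attached to y: but y and z lie
    on the same side and the edge of x and y is not light. *)
Lemma heavy_out_unique x y z :
  arc x y -> arc x z -> (1 < w y)%N -> (1 < w z)%N -> y = z.
Proof.
move=> xy xz wy wz; apply/eqP/negPn/negP => neq_yz.
suff no y' z' : arc x y' -> arc x z' -> (1 < w y')%N ->
    ~ exists t, [/\ t \in [:: x; y'], t \notin [:: x; z'] & attached D t x z'].
  have [|lnk|lnk] := linked xz xy.
  - by rewrite xpair_eqE eqxx eq_sym.
  - exact: no xy xz wy lnk.
  - exact: no xz xy wz lnk.
move=> xy' xz' wy' [t [t' /norP[neq_tx _]]].
move: t'; rewrite !inE (negPf neq_tx) /= => /eqP -> /or3P[].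
- by rewrite lightC => /light_arc/(_ xy') w1; rewrite w1 in wy'.
- by move/light_adj; rewrite same_side // (opposite_sides (arc_adj xy') (arc_adj xz')).
- by move/arc_adj; rewrite same_side // (opposite_sides (arc_adj xy') (arc_adj xz')).
Qed.

(** For two consecutive heavy arcs, the only candidates for a link are edges
    between the same side and the two heavy arcs themselves. *)
Lemma heavy_out_light x y z : arc x y -> arc y z -> (1 < w y)%N -> w z = 1%N.
Proof.
move=> xy yz wy; apply/eqP; rewrite eqn_leq weight_gt0 andbT leqNgt.
apply/negP => wz; have xz : adj x z = false.
  by apply/same_side/(opposite_sides _ (arc_adj yz)); rewrite // adjC arc_adj.
have [|[t [t' tN att]]|[t [t' tN att]]] := linked xy yz.
- by rewrite xpair_eqE negb_and (arc_neq xy).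
- move: tN t' att; rewrite !inE negb_or => /andP[_ /negPf ->] /= /eqP ->.
  case/or3P.
  + by move/light_adj; rewrite adjC xz.
  + by rewrite lightC => /light_arc/(_ yz) w1; rewrite w1 in wz.
  + by rewrite (arcN yz).
- move: tN t' att; rewrite !inE negb_or orbC => /andP[/negPf -> _] /= /eqP ->.
  case/or3P.
  + by move/light_arc/(_ xy) => w1; rewrite w1 in wy.
  + by move/light_adj; rewrite xz.
  + by move/arc_adj; rewrite xz.
Qed.

(** Common to adjacency and light adjacency.  A link between the two edges
    cannot join vertices of the same side, so it is one of the diagonals. *)
Lemma crossing (r : rel 'I_n) a b c d :
    (forall x y, r x y = r y x) -> (forall x y, r x y -> adj x y) ->
    (forall x y, r x y -> exists p q, [/\ arc p q, [:: x; y] =i [:: p; q]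
       & forall t, attached D t p q -> r t p \/ r t q]) ->
  r a b -> r c d -> (a \in A) = (c \in A) -> r a d \/ r c b.
Proof.
move=> rC r_adj r_arc ab cd ac; apply/orP/negPn/negP => /norP[Nad Ncb].
have none s t : s \in [:: a; b] -> t \in [:: c; d] -> r s t = false.
  rewrite !inE => /orP[]/eqP -> /orP[]/eqP ->.
  - by apply/negP => /r_adj; rewrite same_side.
  - exact: negPf.
  - by rewrite rC; apply: negPf.
  - apply/negP => /r_adj.
    by rewrite same_side // (opposite_sides (r_adj _ _ ab) (r_adj _ _ cd)).
have [p [q [pq abE pqP]]] := r_arc _ _ ab.
have [p' [q' [pq' cdE pqP']]] := r_arc _ _ cd.
have [pab qab]: p \in [:: a; b] /\ q \in [:: a; b].
  by split; rewrite abE !inE eqxx ?orbT.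
have [pcd qcd]: p' \in [:: c; d] /\ q' \in [:: c; d].
  by split; rewrite cdE !inE eqxx ?orbT.
have [|[t [+ _]]|[t [+ _]]] := linked pq pq'.
- apply/eqP => -[pE qE].
  have bcd : b \in [:: c; d] by rewrite cdE -pE -qE -abE !inE eqxx orbT.
  by rewrite none ?mem_head in ab.
- by rewrite -cdE => tcd /pqP[]; rewrite rC none.
- by rewrite -abE => tab /pqP'[]; rewrite none.
Qed.

Lemma no_2K2 a b c d : adj a b -> adj c d -> (a \in A) = (c \in A) ->
  adj a d \/ adj c b.
Proof.
apply: crossing => // [x y|x y]; first exact: adjC.
have attP t p q : attached D t p q -> adj t p \/ adj t q.
  by case/or3P=> [/light_adj|/light_adj|/arc_adj]; [left|right|right].
case/orP=> xy; [exists x, y | exists y, x]; split=> // t; try exact: attP.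
by rewrite !inE orbC.
Qed.

Lemma no_light_2K2 a b c d : light a b -> light c d -> (a \in A) = (c \in A) ->
  light a d \/ light c b.
Proof.
apply: crossing => [x y|x y|x y]; [exact: lightC | exact: light_adj |].
have attP t p q : w q = 1%N -> attached D t p q -> light t p \/ light t q.
  move=> wq /or3P[]; [by left | by right | move=> tq; right].
  by rewrite /light tq wq.
case/orP=> /andP[xy /eqP wt]; [exists x, y | exists y, x]; split=> // t;
  try exact: attP.
by rewrite !inE orbC.
Qed.

Definition dominating X v := forall c d, c \in X -> d \in X -> adj c d ->
  (c \in A) = (v \in A) -> adj v d.

(** The variable v then has exponent at most 1 in the generators supported
    in X. *)
Definition nonheavy X v := forall a, a \in X -> arc a v -> w v = 1%N.

(** Take a vertex v with the largest neighbourhood on its side.  If v missed the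
    end d of an edge c - d, the crossing property would put all neighbours of v,
    and d in addition, into the neighbourhood of c. *)
Lemma dominating_exists X c d : c \in X -> d \in X -> adj c d ->
  exists2 v, v \in X & (v \in A) = (c \in A) /\ dominating X v.
Proof.
move=> cX dX cd.
pose nb v := [set u in X | adj v u].
have c0 : (c \in X) && ((c \in A) == (c \in A)) by rewrite cX eqxx.
case: (@arg_maxnP _ c (fun v => (v \in X) && ((v \in A) == (c \in A)))
  (fun v => #|nb v|) c0) => v /andP[vX /eqP vA] max_v.
exists v => //; split=> // a b aX bX ab aA; apply/negPn/negP => Nvb.
have le_av: (#|nb a| <= #|nb v|)%N by apply: max_v; rewrite aX aA vA eqxx.
suff: (#|nb v| < #|nb a|)%N by rewrite ltnNge le_av.
apply: proper_card; apply/properP; split; last first.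
  by exists b; rewrite !inE bX //= ab.
apply/subsetP => u; rewrite !inE => /andP[-> vu] /=.
by case: (no_2K2 vu ab (esym aA)) => [vb|//]; rewrite vb in Nvb.
Qed.

(** Dominating vertices p and q of the two sides are adjacent, so by
    [heavy_out_light] they are not both targets of heavy arcs; let v be one that
    is not.  If v has an arc to a vertex h of weight at least 2 and h has an arc
    to b, then b is the vertex to take: all edges of v except the one to h are
    light, the edge of h and b is light, and crossing them transfers to b the
    domination of v while excluding a heavy arc from b. *)
Lemma splitting_vertex_exists X x y : x \in X -> y \in X -> arc x y ->
  exists v, [/\ v \in X, nonheavy X v, dominating X v
    & forall h b, h \in X -> b \in X -> arc v h -> arc h b -> w h = 1%N].
Proof.
move=> xX yX xy.
have [v [vX nh_v dom_v]]: exists v, [/\ v \in X, nonheavy X v & dominating X v].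
  have [p pX [pA dom_p]] := dominating_exists xX yX (arc_adj xy).
  have [|q qX [qA dom_q]] := dominating_exists yX xX; first by rewrite adjC arc_adj.
  have pq : adj p q.
    have px : adj q x by apply: dom_q yX xX _ (esym qA); rewrite adjC arc_adj.
    apply: dom_p xX qX _ (esym pA); by rewrite adjC.
  have heavyP u : (exists2 a, arc a u & (1 < w u)%N) \/ nonheavy X u.
    case: (pickP (fun a => [&& a \in X, arc a u & (1 < w u)%N])) => [a|none].
      by move=> /and3P[_ au wu]; left; exists a.
    right=> a aX au; apply/eqP; rewrite eqn_leq weight_gt0 andbT leqNgt.
    by have := none a; rewrite aX au => /= ->.
  case: (heavyP p) => [[a ap wp]|nh_p]; last by exists p.
  case: (heavyP q) => [[b bq wq]|nh_q]; last by exists q.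
  case/orP: pq => [pq|qp].
    by move: wq; rewrite (heavy_out_light ap pq).
  by move: wp; rewrite (heavy_out_light bq qp).
have light_in u a : nonheavy X u -> a \in X -> arc a u -> light u a.
  by move=> nh aX au; rewrite /light au (nh a aX au) orbT.
(* Either v itself satisfies the last property, or a path from v through a
   heavy arc to h and on to b gives a better vertex b. *)
case: (pickP (fun e : 'I_n * 'I_n =>
    [&& e.1 \in X, e.2 \in X, arc v e.1, arc e.1 e.2 & (1 < w e.1)%N])); last first.
  move=> none; exists v; split=> // h b hX bX vh hb.
  apply/eqP; rewrite eqn_leq weight_gt0 andbT leqNgt.
  by have := none (h, b); rewrite /= hX bX vh hb => /= ->.
move=> [h b] /= /and5P[hX bX vh hb wh].
have wb : w b = 1%N := heavy_out_light vh hb wh.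
have bv_side : (b \in A) = (v \in A).
  by apply: (opposite_sides (c := h) (arc_adj hb)); rewrite // adjC arc_adj.
have bh_light : light b h by rewrite /light hb wb orbT.
have vh_heavy : light v h = false.
  by apply/negP => /light_arc/(_ vh) w1; rewrite w1 in wh.
have nh_b : nonheavy X b by [].
have v_light d : d \in X -> adj v d -> d != h -> light v d.
  move=> dX /orP[vd|dv] neq_dh; last exact: light_in.
  rewrite /light vd /= eqn_leq weight_gt0 andbT leqNgt; apply/orP; left.
  by apply: contra neq_dh => wd; rewrite (heavy_out_unique vd vh).
exists b; split=> //.
  move=> c d cX dX cd cb; apply/negPn/negP => Nbd.
  have vd : adj v d by apply: dom_v cd _; rewrite // cb bv_side.
  have neq_dh : d != h by apply: contraNneq Nbd => ->; apply: light_adj.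
  case: (no_light_2K2 bh_light (v_light d dX vd neq_dh) bv_side).
    by move/light_adj; rewrite (negPf Nbd).
  by rewrite vh_heavy.
move=> h' b' hX' bX' bh' hb'; apply/eqP; rewrite eqn_leq weight_gt0 andbT leqNgt.
apply/negP => wh'.
have vh' : adj v h' by apply: dom_v (arc_adj bh') _.
have neq_h : h' != h by apply: contraTneq bh' => ->; rewrite (arcN hb).
case: (no_light_2K2 bh_light (v_light h' hX' vh' neq_h) bv_side).
  by move/light_arc/(_ bh') => w1; rewrite w1 in wh'.
by rewrite vh_heavy.
Qed.

(** As v is not the target of a heavy arc, all its edges contain it to the first
    power. *)
Lemma edge_mons_split X v :
    v \in X -> nonheavy X v ->
  edge_mons D X =i [seq (U_(v) + g)%MM | g <-
      [seq (U_(y) *+ (if arc v y then w y else 1))%MM |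
         y <- enum [set y in X | adj v y]]] ++ edge_mons D (X :\ v).
Proof.
move=> vX nh m; rewrite mem_cat -map_comp; apply/edge_monsP/idP.
  move=> [x [y [xy xX yX ->]]].
  have [eq_xv|neq_xv] := eqVneq x v.
    apply/orP; left; apply/mapP; exists y.
      by rewrite mem_enum inE yX arc_adj // -eq_xv.
    by rewrite /= -eq_xv xy.
  have [eq_yv|neq_yv] := eqVneq y v.
    apply/orP; left; apply/mapP; exists x.
      by rewrite mem_enum inE xX adjC arc_adj // -eq_yv.
    rewrite /= -eq_yv (arcN xy) /edge_mon eq_yv (nh x) ?mulm1n -?eq_yv //.
    by rewrite addmC.
  apply/orP; right; apply/edge_monsP; exists x, y.
  by rewrite !inE neq_xv neq_yv xX yX.
case/orP=> [/mapP[y]|/edge_monsP[x [y [xy xX yX ->]]]].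
  rewrite mem_enum inE => /andP[yX /orP[vy|yv]] -> /=.
    by exists v, y; rewrite vy.
  exists y, v; rewrite (arcN yv); split=> //.
  by rewrite /edge_mon (nh y) // mulm1n addmC.
by exists x, y; move: xX yX; rewrite !inE => /andP[_ ->] /andP[_ ->].
Qed.

(** Induction on X, splitting off the vertex v of [splitting_vertex_exists].  An
    edge monomial free of v has an end point on the side opposite to v, which
    is a neighbour of v by domination; if that end point is the source of the
    arc, it occurs to the first power only, and the last property of v makes
    the corresponding power of the cofactor equal to 1. *)
Lemma vertex_splittable_edge_mons (K : fieldType) X :
  vertex_splittable X (ideal_gen (monomials (edge_mons D X)) : polyset K n).
Proof.
have [k] := ubnP #|X|; elim: k X => // k IHk X; rewrite ltnS => le_Xk.
case: (pickP (fun e : 'I_n * 'I_n =>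
    [&& e.1 \in X, e.2 \in X & arc e.1 e.2])); last first.
  move=> none; apply: VSplit_zero; apply: eqset_sym.
  apply: eqset_trans (@mon_ideal_nil K n) (@eq_mon_ideal K n _ _ _) => m.
  apply/esym/negbTE/edge_monsP => -[x [y [xy xX yX _]]].
  by have := none (x, y); rewrite /= xX yX xy.
move=> [x y] /= /and3P[xX yX xy].
have [v [vX nh dom out]] := splitting_vertex_exists xX yX xy.
have eqG := edge_mons_split vX nh.
pose e y := if arc v y then w y else 1%N.
have e_gt0 z : (0 < e z)%N by rewrite /e; case: ifP => // _; apply: weight_gt0.
apply: (vertex_splittable_eqset (@eq_mon_ideal K n _ _ (fun m => esym (eqG m)))).
apply: vertex_splittable_step => //.
- move=> _ /edge_monsP[a [b [_ aX bX ->]]]; move: aX bX; rewrite !inE.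
  by move=> /andP[/negPf va _] /andP[/negPf vb _]; rewrite edge_monE va vb.
- move=> _ /edge_monsP[a [b [ab aX bX ->]]]; move: aX bX; rewrite !inE.
  move=> /andP[_ aX] /andP[_ bX].
  have nb_le z : z \in X -> adj v z -> (e z <= edge_mon D a b z)%N ->
    exists2 g, g \in [seq (U_(y) *+ e y)%MM | y <- enum [set y in X | adj v y]]
      & (g <= edge_mon D a b)%MM.
    move=> zX vz le_z; exists (U_(z) *+ e z)%MM.
      by apply: map_f; rewrite mem_enum inE zX.
    apply/mnm_lepP => t; rewrite mulmnE mnm1E.
    by case: (eqVneq z t) => [<-|_]; rewrite ?mul1n ?mul0n.
  have [av|Nav] := eqVneq (a \in A) (v \in A).
    apply: (nb_le b bX (dom _ _ aX bX (arc_adj ab) av)).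
    rewrite edge_monE eqxx mul1n /e; case: ifP => _; first exact: leq_addl.
    by rewrite addn_gt0 weight_gt0 orbT.
  have bv : (b \in A) = (v \in A).
    have := sideP (arc_adj ab).
    by case: (a \in A) Nav; case: (b \in A); case: (v \in A).
  have ba : adj b a by rewrite adjC arc_adj.
  apply: (nb_le a aX (dom _ _ bX aX ba bv)).
  rewrite edge_monE eqxx /e; case: ifP => // va.
  by rewrite (out a b) // ?leq_addr.
- by move=> a b; rewrite -!eqG; apply: antichain_edge_mons.
- apply: vertex_splittable_powers => [z|||z z'].
  + rewrite mem_enum !inE => /andP[-> vz]; rewrite andbT.
    by apply: contraTneq vz => ->; rewrite same_side.
  + exact: enum_uniq.
  + by move=> z _; apply: e_gt0.
  + move=> _ _; rewrite /e; case: ifP => // vz; case: ifP => // vz'.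
    exact: heavy_out_unique vz vz'.
- by apply: IHk; apply: leq_trans le_Xk; rewrite [ltnRHS](cardsD1 v) vX.
Qed.

End BipartiteGraphs.

(** * The equivalence *)

Theorem theorem4p6 (K : fieldType) (n : nat) (D : wograph n)
    (hD : bipartite (underlying D)) :
  (componentwise_linear (edge_ideal K D) <->
     vertex_splittable [set: 'I_n] (edge_ideal K D)) /\
  (vertex_splittable [set: 'I_n] (edge_ideal K D) <->
     linear_quotients (edge_ideal K D)).
Proof.
have [A sideP] := hD.
have linked_split : arcs_linked D -> vertex_splittable [set: 'I_n] (edge_ideal K D).
  move=> linked; apply: (vertex_splittable_eqset (eqset_sym (@edge_ideal_gens n D K))).
  exact: vertex_splittable_edge_mons sideP linked K _.
split; split.
- by move/componentwise_linear_arcs_linked.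
- exact: vertex_splittable_componentwise_linear.
- exact: vertex_splittable_linear_quotients.
- by move/linear_quotients_arcs_linked.
Qed.
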